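(* The group $\operatorname{Diff}_{\mathcal S}(\mathbb R)_0$ of all diffeomorphisms of $\mathbb R$ of the form $\operatorname{Id}+f$ with $f\in\mathcal S(\mathbb R)$ (and $f'(x)>-1$ for all $x$), with composition as group operation, is a regular Lie group.
   Context: $\mathcal S(\mathbb R)$ is the Fréchet space of rapidly decreasing smooth functions. $\operatorname{Diff}_{\mathcal S}(\mathbb R)_0$ is a manifold via the bijection $\operatorname{Id}+f\mapsto f$ onto the open subset $\{f\in\mathcal S(\mathbb R):f'(x)>-1\ \forall x\}$ of $\mathcal S(\mathbb R)$; its Lie algebra is $\mathcal S(\mathbb R)\partial_x$. A Lie group $G$ (modelled on a convenient vector space, with smooth multiplication and inversion in the convenient sense) with Lie algebra $\mathfrak g$ is regular if for every smooth curve $X:\mathbb R\to\mathfrak g$ there is a smooth curve $g:\mathbb R\to G$ with $g(0)=e$ and $\partial_tg(t)=T_e(\mu^{g(t)})X(t)$ ($\mu^a$ right translation), and the map $C^\infty(\mathbb R,\mathfrak g)\to G$, $X\mapsto g(1)$, is smooth. *)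

(* Defs.v *)
From HB Require Import structures.
From mathcomp Require Import all_boot all_order all_algebra.
From mathcomp Require Import all_classical all_reals all_analysis.
Set Implicit Arguments. Unset Strict Implicit. Unset Printing Implicit Defensive.
Import Order.TTheory GRing.Theory Num.Theory.
Import numFieldNormedType.Exports.
Local Open Scope ring_scope.
Local Open Scope classical_set_scope.

Section Defs.
Variable R : realType.

Definition smoothf (f : R -> R) : Prop :=
  forall (n : nat) (x : R), derivable (derive1n n f) x 1.

Definition schwartz (f : R -> R) : Prop :=
  smoothf f /\ forall k n : nat, exists C : R, forall x : R,
    `| x ^+ k * derive1n n f x | <= C.

(* the chart domain of Diff_S(R)_0 : { f in S(R) | f' > -1 } *)
Definition DiffS (f : R -> R) : Prop :=
  schwartz f /\ forall x : R, -1 < derive1 f x.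

Definition S_lim0 (q : R -> R -> R) (L : R -> R) : Prop :=
  forall (k n : nat) (eps : R), 0 < eps -> exists2 d : R, 0 < d &
    forall h : R, 0 < `|h| < d -> forall x : R,
      `| x ^+ k * derive1n n (fun y => q h y - L y) x | <= eps.

Definition curve_deriv (c : R -> R -> R) (t : R) (V : R -> R) : Prop :=
  schwartz V /\ S_lim0 (fun h x => (c (t + h) x - c t x) / h) V.

Definition smooth_curve (c : R -> R -> R) : Prop :=
  exists D : nat -> R -> R -> R, D 0%N = c /\
    forall (j : nat) (t : R), schwartz (D j t) /\ curve_deriv (D j) t (D j.+1 t).

Definition cinf_open (A : (R -> R) -> Prop) : Prop :=
  forall c, smooth_curve c -> open [set t : R | A (c t)].

(* convenient smoothness: smooth curves are mapped to smooth curves *)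
Definition smooth_on (A : (R -> R) -> Prop) (F : (R -> R) -> (R -> R)) : Prop :=
  forall c, smooth_curve c -> (forall t, A (c t)) -> smooth_curve (fun t => F (c t)).

Definition smooth2_on (A : (R -> R) -> Prop)
    (F : (R -> R) -> (R -> R) -> (R -> R)) : Prop :=
  forall c1 c2, smooth_curve c1 -> smooth_curve c2 ->
    (forall t, A (c1 t)) -> (forall t, A (c2 t)) ->
    smooth_curve (fun t => F (c1 t) (c2 t)).

(* group law in the chart: (Id + f) o (Id + g) = Id + (g + f o (Id + g)) *)
Definition dmul (f g : R -> R) : R -> R := fun x => g x + f (x + g x).

Definition did : R -> R := fun _ => 0.

(* T_e(mu^a) X = V, mu^a the right translation b |-> b o a, written in the chart *)
Definition Te_rtrans (a X V : R -> R) : Prop :=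
  curve_deriv (fun s => dmul (fun x => s * X x) a) 0 V.

(* smooth curves in C^oo(R, S(R)) correspond to smooth maps R x R -> S(R) *)
Definition smooth_family (Xf : R -> R -> R -> R) : Prop :=
  forall a b : R -> R, smoothf a -> smoothf b ->
    smooth_curve (fun u => Xf (a u) (b u)).

Definition is_Lie_group_DiffS : Prop :=
  cinf_open DiffS /\ DiffS did /\
  (forall f g, DiffS f -> DiffS g -> DiffS (dmul f g)) /\
  smooth2_on DiffS dmul /\
  exists inv : (R -> R) -> (R -> R),
    (forall f, DiffS f -> DiffS (inv f) /\ dmul f (inv f) = did /\ dmul (inv f) f = did) /\
    smooth_on DiffS inv.

Definition is_regular_DiffS : Prop :=
  exists Evol : (R -> R -> R) -> (R -> R -> R),
    (forall X, smooth_curve X ->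
       smooth_curve (Evol X) /\ (forall t, DiffS (Evol X t)) /\ Evol X 0 = did /\
       forall t, exists V, Te_rtrans (Evol X t) (X t) V /\ curve_deriv (Evol X) t V) /\
    (forall Xf, smooth_family Xf -> smooth_curve (fun s => Evol (Xf s) 1)).

End Defs.

(* Main.v *)
(* The chart identifies the group with a set of Schwartz functions, and a curve
   into it is smooth exactly when it is a function of (s, x) all of whose
   partial derivatives decay rapidly in x, locally uniformly in s.  Such
   families, with an additional continuous time parameter t, are handled
   coinductively: a family is good as soon as it lies in a class of rapidly
   decaying functions closed, up to sums, products and time primitives, under
   d/ds and d/dx.  For composition and inversion the class consists of the
   functions phi(x + g); for the flow e of a time-dependent field X it also
   contains exp(r I) - 1, where I is the primitive of X_x(x + e), because d/ds e
   and d/dx e solve the variational equation.  Every derivative is identified by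
   a quadratic Taylor estimate, obtained from Gronwall's inequality in the case
   of the flow.  Smoothness of a time evolution in its own time follows by
   rescaling: e(s t) is at time t the flow of s X(s t).  That a map which is
   smooth along smooth curves of the plane has locally bounded partial
   derivatives is Boman's argument, with curves through fast convergent
   sequences. *)

(* Compositions, inverses and flows have no manageable formula for their derivatives of order n, so
   none is ever written: first derivatives of a few generators are computed, and they must land back
   in the algebra of these generators. Time primitives have to be among the closure operations
   because flows and their variations are solutions of integral equations; this is why time is a
   parameter in which only continuity is demanded and which is never differentiated inside a family.
   The order of the estimates is forced. The inverse and the flow are at first mere functions that
   solve an equation separately for each x. The equation yields a bound and a Lipschitz estimate in
   (s, x); these turn the Taylor remainder of the known data into a quadratic remainder for the
   unknown; only then do derivatives exist. Every constant is uniform for x in the whole line and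
   locally uniform in s and t, so the weights [x ^+ k] are the only trace of the topology of the
   Schwartz space. *)
Require Import Defs.
From mathcomp Require Import all_boot all_order all_algebra.
From mathcomp Require Import all_classical all_reals all_analysis.
From mathcomp Require Import ring lra.
Set Implicit Arguments. Unset Strict Implicit. Unset Printing Implicit Defensive.
Import Order.TTheory GRing.Theory Num.Theory.
Import numFieldNormedType.Exports.
Local Open Scope classical_set_scope.
Local Open Scope ring_scope.

(** * One-variable calculus: derivative criteria, mean value bounds, Gronwall *)

Section RealCalculus.
Variable R : realType.
Implicit Types (f g df : R -> R) (x y l : R).

Lemma continuousP_eps f x :
  {for x, continuous f} <->
  forall e, 0 < e -> exists2 d, 0 < d &
    forall y, `|y - x| < d -> `|f y - f x| <= e.
Proof.
split.
  move=> /cvgrPdist_le fx e e0; have /nbhs_ballP[d /= d0 H] := fx e e0.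
  exists d => // y yx; rewrite distrC; apply: (H y).
  by rewrite /ball /= distrC.
move=> H; apply/cvgrPdist_le => e e0; have [d d0 Hd] := H e e0.
apply/nbhs_ballP; exists d => //= y; rewrite /ball /= => yx.
by rewrite distrC; apply: Hd; rewrite distrC.
Qed.

Lemma is_deriveP_eps f x l :
  is_derive x (1:R) f l <->
  forall e, 0 < e -> exists2 d, 0 < d &
    forall h, `|h| < d -> `|f (x + h) - f x - h * l| <= e * `|h|.
Proof.
split.
  move=> [dfx dfl] e e0.
  have /cvgrPdist_le/(_ e e0)/nbhs_ballP[d /= d0 H] :
      (fun h : R => h^-1 *: ((f \o shift x) (h *: 1) - f x)) @ 0^' --> l.
    by rewrite -dfl; exact: dfx.
  exists d => // h hd; have [->|h0] := eqVneq h 0.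
    by rewrite addr0 subrr mul0r subrr normr0 mulr0.
  have := H h; rewrite /ball /= sub0r normrN => /(_ hd h0).
  rewrite /GRing.scale /= mulr1 [h + x]addrC => Hh.
  have -> : f (x + h) - f x - h * l = (h^-1 * (f (x + h) - f x) - l) * h.
    by rewrite mulrBl mulrAC mulVf // mul1r [l * h]mulrC.
  by rewrite normrM ler_wpM2r // distrC.
move=> H.
have : (fun h : R => h^-1 *: ((f \o shift x) (h *: 1) - f x)) @ 0^' --> l.
  apply/cvgrPdist_le => e e0; have [d d0 Hd] := H e e0.
  apply/nbhs_ballP; exists d => //= h; rewrite /ball /= sub0r normrN => hd h0.
  rewrite /GRing.scale /= mulr1 [h + x]addrC.
  have -> : l - h^-1 * (f (x + h) - f x) = - (h^-1 * (f (x + h) - f x - h * l)).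
    by rewrite [in RHS]mulrBr mulrA mulVf // mul1r opprB.
  rewrite normrN normrM normfV mulrC ler_pdivrMr ?normr_gt0 //.
  exact: Hd.
move=> cv; split; first by apply/cvg_ex; exists l.
by apply/cvg_lim.
Qed.

(** A quadratic remainder is [o(h)]. Nearly every derivative that is not given by a calculus rule is
    found in this form. *)
Lemma is_derive_quad f x l (C d : R) : 0 < d ->
  (forall h, `|h| < d -> `|f (x + h) - f x - h * l| <= C * h ^+ 2) ->
  is_derive x (1:R) f l.
Proof.
move=> d0 H; apply/is_deriveP_eps => e e0.
have C1 : 0 < `|C| + 1 by rewrite ltr_wpDl.
exists (Num.min d (e / (`|C| + 1))).
  by rewrite lt_min d0 divr_gt0.
move=> h; rewrite lt_min => /andP[hd he]; apply: (le_trans (H h hd)).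
rewrite ltr_pdivlMr // in he.
rewrite -real_normK ?num_real // expr2 mulrA ler_wpM2r //.
apply: (@le_trans _ _ ((`|C|+1) * `|h|)); last by rewrite mulrC ltW.
by rewrite ler_wpM2r // (le_trans (ler_norm C)) // lerDl.
Qed.

Lemma is_derive_continuous f x l : is_derive x (1:R) f l -> {for x, continuous f}.
Proof.
by move=> [df _]; apply: differentiable_continuous; apply/derivable1_diffP.
Qed.

Lemma is_derive_unique f x l l' :
  is_derive x (1:R) f l -> is_derive x (1:R) f l' -> l = l'.
Proof. by move=> [_ <-] [_ <-]. Qed.

Lemma is_derive_derive1 f x l : is_derive x (1:R) f l -> derive1 f x = l.
Proof. by move=> [_ <-]; rewrite derive1E. Qed.

Lemma derivable_is_derive1 f x :
  derivable f x 1 -> is_derive x (1:R) f (derive1 f x).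
Proof. by move=> d; split => //; rewrite derive1E. Qed.

Lemma is_derive_ext f g x l : (forall y, f y = g y) ->
  is_derive x (1:R) f l -> is_derive x (1:R) g l.
Proof. by move=> /funext ->. Qed.

Lemma is_derive_local f g x l (d : R) : 0 < d ->
  (forall y, `|y - x| < d -> f y = g y) ->
  is_derive x (1:R) f l -> is_derive x (1:R) g l.
Proof.
move=> d0 fg /is_deriveP_eps H; apply/is_deriveP_eps => e e0.
have [d1 d10 H1] := H e e0; exists (Num.min d d1); first by rewrite lt_min d0.
move=> h; rewrite lt_min => /andP[hd hd1].
rewrite -!fg; [exact: H1|by rewrite subrr normr0|by rewrite addrC addKr].
Qed.

Lemma is_derive_affine f (a b x l : R) :
  is_derive (a * x + b) (1:R) f l -> is_derive x (1:R) (fun y => f (a * y + b)) (a * l).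
Proof.
move=> /is_deriveP_eps H; apply/is_deriveP_eps => e e0.
have a1 : 0 < `|a| + 1 by rewrite ltr_wpDl.
have [d d0 Hd] := H (e / (`|a|+1)) (divr_gt0 e0 a1).
exists (d / (`|a|+1)); first exact: divr_gt0.
move=> h; rewrite ltr_pdivlMr // => hd.
have ah : `|a * h| <= (`|a|+1) * `|h| by rewrite normrM ler_wpM2r // lerDl.
have -> : a * (x + h) + b = a * x + b + a * h by ring.
rewrite mulrCA mulrA (le_trans (Hd _ _)) //; first by rewrite (le_lt_trans ah)// mulrC.
by rewrite -mulrA ler_wpM2l ?(ltW e0) // mulrC ler_pdivrMr // [leRHS]mulrC.
Qed.

(** Reparametrizing by the unit interval makes the statement valid for [a] and [b] in any order,
    equality included. *)
Lemma mean_value f df (a b : R) : (forall y, is_derive y (1:R) f (df y)) ->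
  exists2 th, 0 <= th <= 1 & f b - f a = df (a + th * (b - a)) * (b - a).
Proof.
move=> H.
have G y : is_derive y (1:R) (fun u => f ((b - a) * u + a))
    ((b - a) * df ((b - a) * y + a)).
  by apply: is_derive_affine.
have [|th th01] := @MVT_segment R _ _ 0 1 ler01 (fun y _ => G y).
  by apply: continuous_subspaceT => y; apply: is_derive_continuous (G y).
rewrite mulr1 mulr0 add0r subr0 mulr1 subrK => ->.
exists th; last by rewrite mulrC [(b-a)*th]mulrC addrC.
by move: th01; rewrite in_itv.
Qed.

Lemma norm_segment_le (a b th B : R) : 0 <= th <= 1 -> `|a| <= B -> `|b| <= B ->
  `|a + th * (b - a)| <= B.
Proof. by rewrite !ler_norml => *; nra. Qed.

Lemma mean_value_bound f df (a b B C : R) :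
  (forall y, is_derive y (1:R) f (df y)) -> `|a| <= B -> `|b| <= B ->
  (forall y, `|y| <= B -> `|df y| <= C) -> `|f b - f a| <= C * `|b - a|.
Proof.
move=> H aB bB dfC; have [th th01 ->] := mean_value a b H.
by rewrite normrM ler_wpM2r // dfC // norm_segment_le.
Qed.

Lemma nondecreasing_of_derive f df (a b : R) :
  (forall y, a <= y <= b -> is_derive y (1:R) f (df y)) ->
  (forall y, a <= y <= b -> 0 <= df y) -> a <= b -> f a <= f b.
Proof.
move=> H dfp ab; rewrite -subr_ge0.
have [||c /itvP cab ->] := @MVT_segment R f df a b ab.
- by move=> y /itvP yab; apply: H; rewrite !yab.
- apply: continuous_in_subspaceT => y; rewrite inE/= in_itv => /H.
  exact: is_derive_continuous.
- by rewrite mulr_ge0 ?subr_ge0 // dfp // !cab.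
Qed.

(** Both [g + f] and [g - f] are nondecreasing and start from [g 0]. *)
Lemma comparison_ge0 f df g dg (B : R) :
  (forall y, is_derive y (1:R) f (df y)) -> (forall y, is_derive y (1:R) g (dg y)) ->
  f 0 = 0 -> 0 <= g 0 ->
  (forall y, 0 <= y <= B -> `|df y| <= dg y) ->
  forall t, 0 <= t <= B -> `|f t| <= g t.
Proof.
move=> Hf Hg f0 g0 H t /andP[t0 tB]; rewrite ler_norml; apply/andP; split.
- have : (g + f) 0 <= (g + f) t.
    apply: (@nondecreasing_of_derive _ (dg + df)) => // y /andP[y0 yt].
    have := H y; rewrite y0 (le_trans yt tB) => /(_ isT).
    by rewrite ler_norml => /andP[+ _]; rewrite !fctE; lra.
  by rewrite !fctE f0; lra.
- have : (g - f) 0 <= (g - f) t.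
    apply: (@nondecreasing_of_derive _ (dg - df)) => // y /andP[y0 yt].
    have := H y; rewrite y0 (le_trans yt tB) => /(_ isT).
    by rewrite ler_norml => /andP[_]; rewrite !fctE; lra.
  by rewrite !fctE f0; lra.
Qed.

Lemma is_derive_opp_arg f df : (forall y, is_derive y (1:R) f (df y)) ->
  forall y, is_derive y (1:R) (fun u => f (- u)) (- df (- y)).
Proof.
move=> H y; have := @is_derive_affine f (-1) 0 y (df (- y)).
rewrite !mulN1r addr0 => /(_ (H _)).
by apply: is_derive_ext => z; rewrite mulN1r addr0.
Qed.

Lemma is_derive_expRM (a x : R) :
  is_derive x (1:R) (fun u => expR (a * u)) (a * expR (a * x)).
Proof.
have := @is_derive_affine expR a 0 x (expR (a * x)).
rewrite addr0 => /(_ (is_derive_expR _)).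
by apply: is_derive_ext => y; rewrite addr0.
Qed.

Lemma is_derive_addl f (c x l : R) : is_derive x (1:R) f l ->
  is_derive x (1:R) (fun y => c + f y) l.
Proof.
move=> H; have := is_deriveD (is_derive_cst c x 1) H; rewrite add0r.
exact: is_derive_ext.
Qed.

Lemma is_deriveM_fun f g x (l m : R) : is_derive x (1:R) f l -> is_derive x (1:R) g m ->
  is_derive x (1:R) (fun y => f y * g y) (f x * m + l * g x).
Proof.
move=> F G; have := is_deriveM F G.
have -> : f x *: m + g x *: l = f x * m + l * g x by rewrite /GRing.scale /= [g x * l]mulrC.
by apply: is_derive_ext.
Qed.

Lemma is_derive_comp_fun f g x (l m : R) : is_derive x (1:R) g m ->
  is_derive (g x) (1:R) f l -> is_derive x (1:R) (fun y => f (g y)) (l * m).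
Proof.
move=> G F; have := @is_derive1_comp _ f g x l m F G.
exact: is_derive_ext.
Qed.

(** Working with [r ^+ 2] avoids differentiating an absolute value: 2 r r' <= 2 L r^2 + 2 e |r| <=
    (2 L + 1) r^2 + e^2, hence e^2 y - exp(-(2 L + 1) y) r(y)^2 is nondecreasing and vanishes at
    0. *)
Lemma gronwall_ge0 (r dr : R -> R) (B L e : R) : 0 <= L -> 0 <= B ->
  (forall y, is_derive y (1:R) r (dr y)) -> r 0 = 0 ->
  (forall y, 0 <= y <= B -> `|dr y| <= L * `|r y| + e) ->
  forall t, 0 <= t <= B -> r t ^+ 2 <= e ^+ 2 * B * expR ((2 * L + 1) * B).
Proof.
move=> L0 B0 Hr r0 H t /andP[t0 tB].
set M := 2 * L + 1; have M0 : 0 <= M by rewrite /M; lra.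
pose F (y : R) := e ^+ 2 * y - expR (- M * y) * r y ^+ 2.
pose dF (y : R) := e ^+ 2 -
  (expR (- M * y) * (r y * dr y + dr y * r y) + - M * expR (- M * y) * r y ^+ 2).
have HF y : is_derive y (1:R) F (dF y).
  apply: (@is_deriveB _ _ _ (fun y => e ^+ 2 * y)).
    have := @is_derive_affine id (e ^+ 2) 0 y 1 (is_derive_id _ _).
    by rewrite mulr1; apply: is_derive_ext => z; rewrite addr0.
  apply: is_deriveM_fun; first exact: is_derive_expRM.
  exact: is_deriveM_fun.
have F0 : F 0 = 0 by rewrite /F r0; ring.
have : 0 <= F t.
  rewrite -F0; apply: (@nondecreasing_of_derive F dF 0 t) => // y /andP[y0 yt].
  have E0 := expR_gt0 (- M * y).
  have E1 : expR (- M * y) <= 1 by rewrite expR_le1 mulNr oppr_le0 mulr_ge0.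
  have := H y; rewrite y0 (le_trans yt tB) => /(_ isT) Hy.
  have : r y * dr y + dr y * r y - M * r y ^+ 2 <= e ^+ 2.
    rewrite /M -[in r y ^+ 2](real_normK (num_real (r y))).
    have := ler_norm (r y * dr y); rewrite normrM.
    have := normr_ge0 (r y); move: Hy; move: `|r y| `|dr y| => p q Hq p0 hh.
    rewrite [dr y * _]mulrC; have : p * q <= p * (L * p + e) by rewrite ler_wpM2l.
    have := sqr_ge0 (p - e); nra.
  rewrite /dF; set E := expR _ in E0 E1 *; set a := r y * dr y + dr y * r y.
  move=> Ha.
  have -> : e ^+ 2 - (E * a + - M * E * r y ^+ 2) = e ^+ 2 - E * (a - M * r y ^+ 2) by ring.
  rewrite subr_ge0; apply: (@le_trans _ _ (E * e ^+ 2)); first by rewrite ler_pM2l.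
  by rewrite ler_piMl // sqr_ge0.
rewrite /F subr_ge0 => Ht.
have -> : r t ^+ 2 = expR (M * t) * (expR (- M * t) * r t ^+ 2).
  by rewrite mulrA -expRD mulNr subrr expR0 mul1r.
rewrite [leRHS]mulrC; apply: ler_pM => //.
- by rewrite mulr_ge0 ?expR_ge0 ?sqr_ge0.
- by rewrite ler_expR ler_wpM2l.
- by apply: (le_trans Ht); rewrite ler_wpM2l ?sqr_ge0.
Qed.

Lemma gronwall (r dr : R -> R) (B L e : R) : 0 <= L -> 0 <= B ->
  (forall y, is_derive y (1:R) r (dr y)) -> r 0 = 0 ->
  (forall y, `|y| <= B -> `|dr y| <= L * `|r y| + e) ->
  forall t, `|t| <= B -> r t ^+ 2 <= e ^+ 2 * B * expR ((2 * L + 1) * B).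
Proof.
move=> L0 B0 Hr r0 H t tB; have [t0|t0] := leP 0 t.
  apply: (gronwall_ge0 L0 B0 Hr r0) => [y /andP[y0 yB]|].
    by apply: H; rewrite ger0_norm.
  by rewrite t0 -(ger0_norm t0).
have := @gronwall_ge0 (fun u => r (- u)) (fun u => - dr (- u)) B L e L0 B0
  (is_derive_opp_arg Hr).
rewrite oppr0 => /(_ r0) K; rewrite -[t]opprK; apply: K.
  move=> y /andP[y0 yB]; rewrite normrN; apply: H; rewrite normrN.
  by rewrite ger0_norm.
by rewrite oppr_ge0 (ltW t0) -(ltr0_norm t0).
Qed.

(** In the norm weighted by exp(-la |t|) an integration gains the factor 1 / la. With [la] large,
    Picard iteration contracts on a whole bounded interval at once. *)
Lemma exp_comparison f df (B C la : R) : 0 < la -> 0 <= C ->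
  (forall y, is_derive y (1:R) f (df y)) -> f 0 = 0 ->
  (forall y, `|y| <= B -> `|df y| <= C * expR (la * `|y|)) ->
  forall t, `|t| <= B -> `|f t| <= C / la * expR (la * `|t|).
Proof.
move=> la0 C0.
suff K (h dh : R -> R) : (forall y, is_derive y (1:R) h (dh y)) -> h 0 = 0 ->
    (forall y, 0 <= y <= B -> `|dh y| <= C * expR (la * y)) ->
    forall t, 0 <= t <= B -> `|h t| <= C / la * expR (la * t).
  move=> Hf f0 H t tB; have [t0|t0] := leP 0 t.
    rewrite [in leRHS]ger0_norm //; apply: (K _ df) => //.
      by move=> y /andP[y0 yB]; rewrite -[in leRHS](ger0_norm y0) H // ger0_norm.
    by rewrite t0 -(ger0_norm t0).
  have := @K (fun u => f (- u)) (fun u => - df (- u)) (is_derive_opp_arg Hf).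
  rewrite oppr0 [in leRHS]ltr0_norm // => /(_ f0) K'; rewrite -[in leLHS](opprK t).
  apply: K' => [y /andP[y0 yB]|].
    rewrite normrN (le_trans (H _ _)) ?normrN ?ger0_norm //.
  by rewrite oppr_ge0 (ltW t0) -(ltr0_norm t0).
move=> Hh h0 H t tB.
apply: (@comparison_ge0 h dh (fun y => C / la * expR (la * y))
  (fun y => C / la * (la * expR (la * y))) B) => //.
- move=> y; have := @is_deriveZ _ _ _ _ (C / la) y 1 _ (is_derive_expRM la y).
  exact: is_derive_ext.
- by rewrite !mulr_ge0 ?expR_ge0 // invr_ge0 ltW.
- by move=> y /H; rewrite mulrA divfK // gt_eqF.
Qed.

End RealCalculus.

(** * Compactness on squares, geometric limits, primitives of continuous functions *)

Section Tools.
Variable R : realType.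

(** Compactness in the near-covering form, with the filter at infinity on [N]. The number [N] stands
    for a bound, so that locally valid bounds become one bound on the square. *)
Lemma locally_uniform_on_square (Q : nat -> R -> R -> Prop) :
  (forall N M a b, (N <= M)%N -> Q N a b -> Q M a b) ->
  (forall a b, exists N, exists2 d, 0 < d &
    forall a' b', `|a' - a| < d -> `|b' - b| < d -> Q N a' b') ->
  forall B, exists N, forall a b, `|a| <= B -> `|b| <= B -> Q N a b.
Proof.
move=> Qmono Qloc B.
have cK : compact (`[-B, B] `*` `[-B, B] : set (R * R)%type).
  by apply: compact_setX; exact: segment_compact.
have := (iffLR (compact_near_coveringP _) cK) nat \oo
  (fun N (z : R * R) => Q N z.1 z.2) _.
case.
  move=> [a b] _; have [N [d d0 H]] := Qloc a b.
  exists (ball (a, b) d, [set n | (N <= n)%N]); first split => /=.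
  - exact: nbhsx_ballx.
  - by exists N.
  move=> [[a' b'] n] /= [[/= Ha Hb] Nn]; apply: (Qmono N) => //.
  by apply: H; rewrite distrC.
move=> N _ HN; exists N => a b aB bB.
apply: (HN N (leqnn N) (a, b)); split; rewrite /= in_itv /=;
  by rewrite -ler_norml.
Qed.

(** Takes the place of a passage to the limit whenever an approximation is known with geometric
    error. *)
Lemma le_of_le_add_geometric (a b C : R) : (forall n, a <= b + C / 2 ^+ n) -> a <= b.
Proof.
move=> H; rewrite leNgt; apply/negP => ba.
have C0 : 0 < a - b by rewrite subr_gt0.
have Cp : 0 < C.
  have := H 0%N; rewrite expr0 divr1; lra.
have [n Hn] : exists n, C / (a - b) < n%:R.
  exists (Num.truncn (C / (a - b))).+1.
  by apply: real_truncnS_gt; exact: num_real.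
have n2 : (n%:R : R) < 2 ^+ n by rewrite -natrX ltr_nat ltn_expl.
have := H n; rewrite -lerBlDl ler_pdivlMr ?exprn_gt0 //.
rewrite leNgt => /negP; apply; rewrite ltr_pdivrMr // in Hn.
by rewrite mulrC (lt_trans Hn) // ltr_pM2r.
Qed.

(** The intervals of radius [2 * K / 2 ^+ n] about [u n] are nested; the limit is the supremum of
    their left ends. *)
Lemma geometric_cauchy (u : nat -> R) (K : R) :
  (forall n, `|u n.+1 - u n| <= K / 2 ^+ n) ->
  exists l, forall n, `|u n - l| <= 2 * K / 2 ^+ n.
Proof.
move=> H; pose a n := u n - 2 * K / 2 ^+ n; pose b n := u n + 2 * K / 2 ^+ n.
have half n : 2 * K / 2 ^+ n.+1 = K / 2 ^+ n.
  by rewrite exprS; field; rewrite expf_neq0 //.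
have full n : 2 * K / 2 ^+ n = 2 * (K / 2 ^+ n) by rewrite mulrA.
have aS n : a n <= a n.+1.
  by have := H n; rewrite /a half full ler_norml; lra.
have bS n : b n.+1 <= b n.
  by have := H n; rewrite /b half full ler_norml; lra.
have K0 n : 0 <= K / 2 ^+ n by apply: le_trans (H n).
have ab n m : a n <= b m.
  apply: (@le_trans _ _ (a (maxn n m))).
    by apply: (homo_leq (@lexx _ _) (@le_trans _ _) aS); rewrite leq_maxl.
  apply: (@le_trans _ _ (b (maxn n m))).
    by have := K0 (maxn n m); rewrite /a /b full; lra.
  apply: (homo_leq (r := fun x y => y <= x)); rewrite ?leq_maxr //.
  by move=> y x z yx zy; exact: le_trans zy yx.
have supa : has_sup (range a).
  by split; [exists (a 0%N), 0%N|exists (b 0%N) => _ [n _ <-]].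
exists (sup (range a)) => n; rewrite ler_norml; apply/andP; split.
  suff : sup (range a) <= b n by rewrite /b; lra.
  by apply: ge_sup; [case: supa|move=> _ [m _ <-]].
suff : a n <= sup (range a) by rewrite /a; lra.
by apply: ub_le_sup; [case: supa|exists n].
Qed.

Lemma antiderivative_on (f : R -> R) (B : R) : (forall t, {for t, continuous f}) ->
  exists2 F : R -> R, F 0 = 0 & forall t, `|t| < B -> is_derive t (1:R) F (f t).
Proof.
move=> cf.
pose F0 (x : R) : R := (\int[@lebesgue_measure R]_(t in [set` `[- B, x]]) (f t))%R.
pose F x := F0 x - F0 0.
exists F => [|t]; first by rewrite /F subrr.
rewrite ltr_norml => /andP[tB Bt].
have [|d e] := @continuous_FTC1_closed R f (- B) t B Bt _ tB (cf t).
  apply: continuous_compact_integrable; first exact: segment_compact.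
  exact: continuous_subspaceT.
have : is_derive t (1:R) F0 (f t) by rewrite -e; exact: derivable_is_derive1.
move=> H; have := is_deriveB H (is_derive_cst (F0 0) t 1).
by rewrite subr0; apply: is_derive_ext.
Qed.

(** The antiderivatives on the intervals |t| < n all vanish at 0, so they agree where two of them
    are defined and can be glued. *)
Lemma antiderivative_exists (f : R -> R) : (forall t, {for t, continuous f}) ->
  exists F : R -> R, F 0 = 0 /\ forall t, is_derive t (1:R) F (f t).
Proof.
move=> cf.
have /choice[G GP] : forall n : nat, exists F : R -> R, F 0 = 0 /\
    forall t, `|t| < n%:R -> is_derive t (1:R) F (f t).
  by move=> n; have [F ? ?] := antiderivative_on n%:R cf; exists F.
have Gmono n m t : (n <= m)%N -> `|t| < n%:R -> G n t = G m t.
  move=> nm tn.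
  have tm : `|t| < m%:R by rewrite (lt_le_trans tn) // ler_nat.
  have D s : `|s| <= `|t| -> is_derive s (1:R) (G n - G m) 0.
    move=> st; rewrite -(subrr (f s)); apply: is_deriveB; apply: (GP _).2.
      exact: le_lt_trans tn.
    exact: le_lt_trans tm.
  have D' s : `|s| <= `|t| -> is_derive s (1:R) (- (G n - G m)) 0.
    by move=> st; rewrite -oppr0; apply: is_deriveN; exact: D.
  have G0 : (G n - G m) 0 = 0 by rewrite !fctE (GP n).1 (GP m).1 subrr.
  have NG0 : (- (G n - G m)) 0 = 0 by rewrite -[LHS]/(- ((G n - G m) 0)) G0 oppr0.
  suff : (G n - G m) t = 0 by rewrite !fctE => /subr0_eq.
  apply/eqP; rewrite eq_le; have [t0|t0] := leP 0 t.
    have S s : 0 <= s <= t -> `|s| <= `|t|.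
      by move=> /andP[s0 st]; rewrite !ger0_norm.
    have := @nondecreasing_of_derive _ (- (G n - G m)) (fun=> 0) 0 t
        (fun s hs => D' s (S s hs)) (fun _ _ => lexx 0) t0.
    have := @nondecreasing_of_derive _ (G n - G m) (fun=> 0) 0 t
        (fun s hs => D s (S s hs)) (fun _ _ => lexx 0) t0.
    by rewrite G0 NG0 -[X in _ -> _ <= X -> _]/(- ((G n - G m) t)) oppr_ge0 => -> ->.
  have S s : t <= s <= 0 -> `|s| <= `|t|.
    by move=> /andP[s0 st]; rewrite !ler0_norm ?lerN2 // ltW.
  have := @nondecreasing_of_derive _ (- (G n - G m)) (fun=> 0) t 0
      (fun s hs => D' s (S s hs)) (fun _ _ => lexx 0) (ltW t0).
  have := @nondecreasing_of_derive _ (G n - G m) (fun=> 0) t 0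
      (fun s hs => D s (S s hs)) (fun _ _ => lexx 0) (ltW t0).
  by rewrite G0 NG0 -[X in _ -> X <= _ -> _]/(- ((G n - G m) t)) oppr_le0 => -> ->.
pose N (t : R) := (Num.truncn `|t|).+1.
have NP t : `|t| < (N t)%:R.
  by apply: real_truncnS_gt; exact: num_real.
exists (fun t => G (N t) t); split; first exact: (GP _).1.
(* One index more than [N t]: it serves all points at distance less than 1 from [t], whereas [N]
   itself may jump there. *)
move=> t; have := (GP (N t).+1).2 t.
have Nt : `|t| < (N t).+1%:R by rewrite (lt_trans (NP t)) // ltr_nat.
move=> /(_ Nt).
apply: (@is_derive_local _ _ _ _ _ 1) => // y yt.
have yN : `|y| < (N t).+1%:R.
  have -> : y = t + (y - t) by ring.
  by rewrite (le_lt_trans (ler_normD _ _)) // -natr1 ltrD.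
have [NyN|NNy] := leqP (N y) (N t).+1.
  by rewrite (@Gmono (N y) (N t).+1).
by rewrite (@Gmono (N t).+1 (N y)) // ltnW.
Qed.

(** A chosen antiderivative; the integral serves only to show that one exists, and all later
    arguments use the two properties of [primitiveP]. *)
Definition primitive (f : R -> R) : R -> R :=
  get [set F : R -> R | F 0 = 0 /\ forall t, is_derive t (1:R) F (f t)].

Lemma primitiveP (f : R -> R) : (forall t, {for t, continuous f}) ->
  primitive f 0 = 0 /\ forall t, is_derive t (1:R) (primitive f) (f t).
Proof.
move=> /antiderivative_exists[F HF]; rewrite /primitive.
by case: xgetP => [y _ //|/(_ F)].
Qed.

End Tools.

(** * Global existence for ordinary differential equations *)

Section Picard.
Variable R : realType.

Lemma continuous_time_dependent (F : R -> R -> R) (y : R -> R) :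
  (forall z t, {for t, continuous (F ^~ z)}) ->
  (forall B, exists L, forall t x z, `|t| <= B -> `|F t x - F t z| <= L * `|x - z|) ->
  (forall t, {for t, continuous y}) ->
  forall t, {for t, continuous (fun t => F t (y t))}.
Proof.
move=> Fc FL yc t; apply/continuousP_eps => e e0.
have [L HL] := FL (`|t| + 1).
have e2 : 0 < e / 2 by lra.
have L1 : 0 < `|L| + 1 by rewrite ltr_wpDl.
have [d1 d10 H1] := iffLR (continuousP_eps _ _) (Fc (y t) t) _ e2.
have [d2 d20 H2] := iffLR (continuousP_eps _ _) (yc t) _ (divr_gt0 e2 L1).
exists (Num.min 1 (Num.min d1 d2)); first by rewrite !lt_min ltr01 d10.
move=> s; rewrite !lt_min => /and3P[st1 st2 st3].
have sB : `|s| <= `|t| + 1.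
  by rewrite -(subrK t s) addrC (le_trans (ler_normD _ _)) // lerD2l ltW.
have -> : F s (y s) - F t (y t) =
  (F s (y s) - F s (y t)) + (F s (y t) - F t (y t)) by ring.
rewrite (le_trans (ler_normD _ _)) // (splitr e) lerD ?H1 //.
rewrite (le_trans (HL s _ _ sB)) //.
apply: (@le_trans _ _ ((`|L| + 1) * `|y s - y t|)).
  by rewrite ler_wpM2r // (le_trans (ler_norm L)) // lerDl.
by rewrite mulrC -ler_pdivlMr // H2.
Qed.

Lemma continuous_of_locally_lipschitz (y : R -> R) :
  (forall B, exists M, forall t s, `|t| <= B -> `|s| <= B -> `|y t - y s| <= M * `|t - s|) ->
  forall t, {for t, continuous y}.
Proof.
move=> H t; apply/continuousP_eps => e e0.
have [M HM] := H (`|t| + 1).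
have M1 : 0 < `|M| + 1 by rewrite ltr_wpDl.
exists (Num.min 1 (e / (`|M| + 1))); first by rewrite lt_min ltr01 divr_gt0.
move=> s; rewrite lt_min ltr_pdivlMr // => /andP[st1 ste].
apply: (le_trans (HM s t _ _)).
- by rewrite -(subrK t s) addrC (le_trans (ler_normD _ _)) // lerD2l ltW.
- by rewrite lerDl.
apply: le_trans (ltW ste); rewrite mulrC ler_wpM2l //.
by rewrite (le_trans (ler_norm M)) // lerDl.
Qed.

(** The bounds hold for all [z], so no solution can escape and the iterates converge on every
    interval [-B, B]. *)
Lemma picard_lindelof (F : R -> R -> R) :
  (forall z t, {for t, continuous (F ^~ z)}) ->
  (forall B, exists M, forall t z, `|t| <= B -> `|F t z| <= M) ->
  (forall B, exists L, forall t x z, `|t| <= B -> `|F t x - F t z| <= L * `|x - z|) ->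
  exists y : R -> R, y 0 = 0 /\ forall t, is_derive t (1:R) y (F t (y t)).
Proof.
move=> Fc Fb FL.
pose Y n := iter n (fun y : R -> R => primitive (fun t => F t (y t))) (fun=> 0).
have Yc n t : {for t, continuous (Y n)}.
  elim: n t => [|n IH] t; first exact: cvg_cst.
  have := (primitiveP (continuous_time_dependent Fc FL IH)).2 t.
  exact: is_derive_continuous.
have Y0 n : Y n 0 = 0.
  by case: n => [//|n]; exact: (primitiveP (continuous_time_dependent Fc FL (Yc n))).1.
have dY n t : is_derive t (1:R) (Y n.+1) (F t (Y n t)).
  exact: (primitiveP (continuous_time_dependent Fc FL (Yc n))).2.
have Ylip B M : (forall t z, `|t| <= B -> `|F t z| <= M) ->
    forall n t s, `|t| <= B -> `|s| <= B -> `|Y n t - Y n s| <= M * `|t - s|.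
  move=> HM n t s tB sB.
  have M0 : 0 <= M by apply: le_trans (HM t 0 tB).
  case: n => [|n]; first by rewrite subrr normr0 mulr_ge0.
  apply: (@mean_value_bound _ (Y n.+1) (fun t => F t (Y n t)) s t B M) => // u uB.
  exact: HM.
have Ycauchy B : 0 <= B -> exists K, forall n t, `|t| <= B ->
    `|Y n.+1 t - Y n t| <= K / 2 ^+ n.
  move=> B0; have [M HM] := Fb B; have [L' HL'] := FL B.
  pose L := `|L'| + 1; have L0 : 0 < L by rewrite ltr_wpDl.
  have HL t x z : `|t| <= B -> `|F t x - F t z| <= L * `|x - z|.
    move=> tB; apply: (le_trans (HL' t x z tB)); rewrite ler_wpM2r //.
    by rewrite (le_trans (ler_norm L')) // lerDl.
  have M0 : 0 <= M by apply: (le_trans _ (HM 0 0 _)) => //; rewrite normr0.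
  (* With this weight one iteration multiplies the distance by L / la = 1/2, the rate that
     [geometric_cauchy] expects. *)
  pose la := 2 * L; have la0 : 0 < la by rewrite mulr_gt0.
  have exp1 (t : R) : 1 <= expR (la * `|t|).
    by rewrite -expR0 ler_expR mulr_ge0 // ltW.
  have K n t : `|t| <= B ->
      `|Y n.+1 t - Y n t| <= M / la / 2 ^+ n * expR (la * `|t|).
    elim: n t => [|n IH] t tB.
      rewrite expr0 divr1 subr0.
      apply: (@exp_comparison _ _ _ B _ _ la0 M0 (dY 0%N)) => // u uB.
      by apply: (le_trans (HM _ _ uB)); rewrite ler_peMr.
    have -> : M / la / 2 ^+ n.+1 = (L * (M / la / 2 ^+ n)) / la.
      by rewrite exprS /la; field; rewrite gt_eqF //= expf_neq0.
    apply: (@exp_comparison _ (fun t => Y n.+2 t - Y n.+1 t)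
      (fun t => F t (Y n.+1 t) - F t (Y n t)) B _ _ la0) => //.
    - by rewrite !mulr_ge0 // ?invr_ge0 // ltW // exprn_gt0.
    - by rewrite !Y0 subrr.
    - move=> u uB; apply: (le_trans (HL _ _ _ uB)); rewrite -[leRHS]mulrA.
      by rewrite ler_wpM2l ?(ltW L0) // IH.
  exists (M / la * expR (la * B)) => n t tB; apply: (le_trans (K n t tB)).
  rewrite mulrAC ler_wpM2r ?invr_ge0 ?exprn_ge0 //.
  by rewrite ler_wpM2l ?divr_ge0 // ?(ltW la0) // ler_expR ler_wpM2l // ltW.
(* The limit is chosen pointwise with a constant depending on [t]; uniqueness of limits then makes
   the error uniform on [-B, B]. *)
have /choice[y Hy] : forall t, exists l, exists C, forall n, `|Y n t - l| <= C / 2 ^+ n.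
  move=> t; have [K HK] := Ycauchy `|t| (normr_ge0 t).
  have [l Hl] := geometric_cauchy (fun n => HK n t (lexx _)).
  by exists l, (2 * K).
have yapprox B : 0 <= B -> exists C, forall n t, `|t| <= B -> `|Y n t - y t| <= C / 2 ^+ n.
  move=> B0; have [K HK] := Ycauchy B B0; exists (2 * K) => n t tB.
  have [l Hl] := geometric_cauchy (fun n => HK n t tB).
  suff -> : y t = l by [].
  have [C HC] := Hy t; apply/eqP; rewrite -subr_eq0 -normr_le0.
  apply: (@le_of_le_add_geometric _ _ _ (C + 2 * K)) => k; rewrite add0r mulrDl.
  have -> : y t - l = (Y k t - l) - (Y k t - y t) by ring.
  by rewrite (le_trans (ler_normB _ _)) // addrC lerD.
have yc t : {for t, continuous y}.
  apply: continuous_of_locally_lipschitz => B.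
  have [M HM] := Fb B; exists M => s u sB uB.
  have B0 : 0 <= B by apply: le_trans sB.
  have [C HC] := yapprox B B0.
  apply: (@le_of_le_add_geometric _ _ _ (C + C)) => k; rewrite mulrDl.
  have -> : y s - y u = (Y k s - Y k u) + (- (Y k s - y s) + (Y k u - y u)) by ring.
  rewrite (le_trans (ler_normD _ _)) // lerD ?(Ylip B) //.
  by rewrite (le_trans (ler_normD _ _)) // normrN lerD ?HC.
have [Z0 dZ] := primitiveP (continuous_time_dependent Fc FL yc).
set Z := primitive _ in Z0 dZ.
(* [Y k.+1] is geometrically close to [y] and, being a primitive of [F t (Y k t)], also to [Z]. *)
have yZ : y = Z.
  apply/funext => t; set B := `|t|.
  have [C HC] := yapprox B (normr_ge0 t); have [L' HL'] := FL B.
  apply/eqP; rewrite -subr_eq0 -normr_le0.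
  apply: (@le_of_le_add_geometric _ _ _ (C / 2 + `|L'| * C * B)) => k.
  rewrite add0r mulrDl.
  have -> : y t - Z t = - (Y k.+1 t - y t) + (Y k.+1 t - Z t) by ring.
  rewrite (le_trans (ler_normD _ _)) // normrN lerD //.
    by rewrite (le_trans (HC k.+1 t (lexx _))) // exprS invfM mulrA.
  have := @mean_value_bound _ (Y k.+1 - Z) (fun t => F t (Y k t) - F t (y t)) 0 t B
    (`|L'| * (C / 2 ^+ k)) (fun u => is_deriveB (dY k u) (dZ u)).
  rewrite !fctE Y0 Z0 !subr0 normr0 => /(_ (normr_ge0 t) (lexx _)) W.
  rewrite (le_trans (W _)) //; last by rewrite -/B !mulrA mulrAC.
  move=> u uB; apply: (le_trans (HL' u _ _ uB)).
  apply: (le_trans (ler_wpM2r (normr_ge0 _) (ler_norm L'))).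
  by rewrite ler_wpM2l // HC.
by exists y; split=> [|t]; [rewrite yZ|rewrite [in X in is_derive _ _ X _]yZ].
Qed.

End Picard.

(** * Families of rapidly decaying functions and coinduction up to closure *)

Section Families.
Variable R : realType.
Local Notation fam := (R -> R -> R -> R).
Implicit Types (a b c : fam) (K : fam -> Prop).

Definition rapid a := forall k B, exists C, forall s t x,
  `|s| <= B -> `|t| <= B -> `|x ^+ k * a s t x| <= C.

(** The regularity in (s, x) that can be had before differentiability is known. It is what makes the
    remainders of compositions and primitives quadratic. *)
Definition lipschitz_sx a := forall B, exists C, forall s s' t x x',
  `|s| <= B -> `|s'| <= B -> `|t| <= B ->
  `|a s' t x' - a s t x| <= C * (`|s' - s| + `|x' - x|).

Definition tcont a := forall s x t, {for t, continuous (fun t => a s t x)}.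

Definition s_derivative a b := forall s t x,
  is_derive s (1:R) (fun s => a s t x) (b s t x).

Definition x_derivative a b := forall s t x, is_derive x (1:R) (a s t) (b s t x).

(** A greatest fixed point in impredicative form: [K] is an invariant class, as in a proof by
    bisimulation. *)
Definition schwartz_family a := exists2 K : fam -> Prop, K a &
  forall b, K b -> [/\ rapid b, tcont b,
    exists2 c, K c & s_derivative b c & exists2 c, K c & x_derivative b c].

Definition ds a : fam := fun s t x => derive1 (fun s => a s t x) s.
Definition dx a : fam := fun s t x => derive1 (a s t) x.

Lemma dsE a b : s_derivative a b -> ds a = b.
Proof. by move=> H; do 3 apply/funext => ?; apply: is_derive_derive1. Qed.

Lemma dxE a b : x_derivative a b -> dx a = b.
Proof. by move=> H; do 3 apply/funext => ?; apply: is_derive_derive1. Qed.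

Lemma schwartz_family_unfold a : schwartz_family a ->
  [/\ rapid a, tcont a, s_derivative a (ds a) /\ schwartz_family (ds a)
    & x_derivative a (dx a) /\ schwartz_family (dx a)].
Proof.
move=> [K Ka HK]; have [ra ca [b Kb ab] [c Kc ac]] := HK a Ka.
rewrite (dsE ab) (dxE ac); split=> //; split=> //; exists K => //.
Qed.

Lemma schwartz_family_rapid a : schwartz_family a -> rapid a.
Proof. by case/schwartz_family_unfold. Qed.
Lemma schwartz_family_tcont a : schwartz_family a -> tcont a.
Proof. by case/schwartz_family_unfold. Qed.
Lemma schwartz_family_ds a : schwartz_family a -> schwartz_family (ds a).
Proof. by case/schwartz_family_unfold => _ _ []. Qed.
Lemma schwartz_family_dx a : schwartz_family a -> schwartz_family (dx a).
Proof. by case/schwartz_family_unfold => _ _ _ []. Qed.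
Lemma s_derivative_ds a : schwartz_family a -> s_derivative a (ds a).
Proof. by case/schwartz_family_unfold => _ _ []. Qed.
Lemma x_derivative_dx a : schwartz_family a -> x_derivative a (dx a).
Proof. by case/schwartz_family_unfold => _ _ _ []. Qed.

Lemma rapid_bound a k B : rapid a -> exists2 C, 0 <= C &
  forall s t x, `|s| <= B -> `|t| <= B -> `|x ^+ k * a s t x| <= C.
Proof.
move=> ra; have [C HC] := ra k B; exists `|C| => // s t x sB tB.
by rewrite (le_trans (HC s t x sB tB)) // ler_norm.
Qed.

Lemma rapid_bound0 a B : rapid a -> exists2 C, 0 <= C &
  forall s t x, `|s| <= B -> `|t| <= B -> `|a s t x| <= C.
Proof.
move=> ra; have [C C0 HC] := rapid_bound 0 B ra; exists C => // s t x sB tB.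
by have := HC s t x sB tB; rewrite expr0 mul1r.
Qed.

Lemma lipschitz_sx_bound a B : lipschitz_sx a -> exists2 C, 0 <= C &
  forall s s' t x x', `|s| <= B -> `|s'| <= B -> `|t| <= B ->
  `|a s' t x' - a s t x| <= C * (`|s' - s| + `|x' - x|).
Proof.
move=> la; have [C HC] := la B; exists `|C| => // s s' t x x' sB s'B tB.
by rewrite (le_trans (HC _ _ _ _ _ sB s'B tB)) // ler_wpM2r ?ler_norm // addr_ge0.
Qed.

Lemma schwartz_family_lipschitz a : schwartz_family a -> lipschitz_sx a.
Proof.
move=> Sa B.
have [C1 C10 H1] := rapid_bound0 B (schwartz_family_rapid (schwartz_family_ds Sa)).
have [C2 C20 H2] := rapid_bound0 B (schwartz_family_rapid (schwartz_family_dx Sa)).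
exists (C1 + C2) => s s' t x x' sB s'B tB.
have -> : a s' t x' - a s t x = (a s' t x' - a s t x') + (a s t x' - a s t x) by ring.
rewrite (le_trans (ler_normD _ _)) //.
have A1 : `|a s' t x' - a s t x'| <= C1 * `|s' - s|.
  apply: (@mean_value_bound _ _ _ s s' B C1
    (fun s => s_derivative_ds Sa s t x')) => // y yB.
  exact: H1.
have A2 : `|a s t x' - a s t x| <= C2 * `|x' - x|.
  have [th _ ->] := mean_value x x' (x_derivative_dx Sa s t).
  by rewrite normrM ler_wpM2r // H2.
have := normr_ge0 (s' - s); have := normr_ge0 (x' - x); nra.
Qed.

(** First [s] moves at the point [x'], then [x] moves at the parameter [s]; each mean value is
    compared with the base point by the Lipschitz bound of a first derivative. *)
Lemma schwartz_family_taylor a : schwartz_family a -> forall B, exists2 C, 0 <= C &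
  forall s s' t x x', `|s| <= B -> `|s'| <= B -> `|t| <= B ->
  `|a s' t x' - a s t x - ((s' - s) * ds a s t x + (x' - x) * dx a s t x)|
    <= C * (`|s' - s| + `|x' - x|) ^+ 2.
Proof.
move=> Sa B.
have [C1 C10 H1] := lipschitz_sx_bound B
  (schwartz_family_lipschitz (schwartz_family_ds Sa)).
have [C2 C20 H2] := lipschitz_sx_bound B
  (schwartz_family_lipschitz (schwartz_family_dx Sa)).
exists (C1 + C2); first exact: addr_ge0.
move=> s s' t x x' sB s'B tB.
have [th1 th1P E1] := mean_value s s' (fun s => s_derivative_ds Sa s t x').
have [th2 th2P E2] := mean_value x x' (x_derivative_dx Sa s t).
have A1 := H1 s (s + th1 * (s' - s)) t x x' sB (norm_segment_le th1P sB s'B) tB.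
have A2 := H2 s s t x (x + th2 * (x' - x)) sB sB tB.
rewrite [s + _ - s]addrC addKr normrM in A1.
rewrite [x + _ - x]addrC addKr normrM subrr normr0 add0r in A2.
have [t10 t11] := andP th1P; have [t20 t21] := andP th2P.
rewrite (ger0_norm t10) in A1; rewrite (ger0_norm t20) in A2.
have -> : a s' t x' - a s t x - ((s' - s) * ds a s t x + (x' - x) * dx a s t x) =
   (ds a (s + th1 * (s' - s)) t x' - ds a s t x) * (s' - s)
   + (dx a s t (x + th2 * (x' - x)) - dx a s t x) * (x' - x).
  by rewrite !mulrBl -E1 -E2; ring.
rewrite (le_trans (ler_normD _ _)) // !normrM; move: A1 A2.
move: `|ds a _ _ _ - _| `|dx a _ _ _ - _| (normr_ge0 (s' - s)) (normr_ge0 (x' - x)).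
move: `|s' - s| `|x' - x| => p q u v p0 q0 U V.
have U' : u <= C1 * (p + q) by apply: (le_trans U); rewrite ler_wpM2l // lerD2r ler_piMl.
have V' : v <= C2 * (p + q).
  by apply: (le_trans V); rewrite ler_wpM2l // (@le_trans _ _ q) ?ler_piMl // lerDr.
have W1 : u * p <= C1 * (p + q) * p by rewrite ler_wpM2r.
have W2 : v * q <= C2 * (p + q) * q by rewrite ler_wpM2r.
apply: (le_trans (lerD W1 W2)).
have -> : (C1 + C2) * (p + q) ^+ 2 = C1 * (p + q) * p + C2 * (p + q) * q
  + (C1 * (p + q) * q + C2 * (p + q) * p) by ring.
by rewrite lerDl addr_ge0 // !mulr_ge0 // addr_ge0.
Qed.

Lemma s_derivative_quad a b :
  (forall B, exists C, forall s s' t x, `|s| <= B -> `|s'| <= B -> `|t| <= B ->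
    `|a s' t x - a s t x - (s' - s) * b s t x| <= C * (s' - s) ^+ 2) ->
  s_derivative a b.
Proof.
move=> H s t x; have [C HC] := H (`|s| + `|t| + 1).
apply: (@is_derive_quad _ _ _ _ C 1) => // h h1.
have := HC s (s + h) t x; rewrite [s + h - s]addrC addKr; apply.
- by have := normr_ge0 t; lra.
- by rewrite (le_trans (ler_normD _ _)) //; have := normr_ge0 t; lra.
- by have := normr_ge0 s; lra.
Qed.

Lemma x_derivative_quad a b :
  (forall B, exists C, forall s t x x', `|s| <= B -> `|t| <= B ->
    `|a s t x' - a s t x - (x' - x) * b s t x| <= C * (x' - x) ^+ 2) ->
  x_derivative a b.
Proof.
move=> H s t x; have [C HC] := H (`|s| + `|t|).
apply: (@is_derive_quad _ _ _ _ C 1) => // h h1.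
have := HC s t x (x + h); rewrite [x + h - x]addrC addKr; apply.
- by rewrite lerDl.
- by rewrite lerDr.
Qed.

Definition time_primitive a : fam := fun s t x => primitive (fun t => a s t x) t.

(** The operations are those whose derivative is built from the derivatives of the operands by the
    same operations; for primitives this is differentiation under the integral sign. Known Schwartz
    families enter as coefficients. *)
Inductive closure_of K : fam -> Prop :=
| closure_base a : K a -> closure_of K a
| closure_schwartz a : schwartz_family a -> closure_of K a
| closure_add a b : closure_of K a -> closure_of K b ->
    closure_of K (fun s t x => a s t x + b s t x)
| closure_mul a b : closure_of K a -> closure_of K b ->
    closure_of K (fun s t x => a s t x * b s t x)
| closure_scale r a : closure_of K a -> closure_of K (fun s t x => r * a s t x)
| closure_primitive a : closure_of K a -> closure_of K (time_primitive a).

Lemma rapid_add a b : rapid a -> rapid b -> rapid (fun s t x => a s t x + b s t x).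
Proof.
move=> ra rb k B; have [C1 H1] := ra k B; have [C2 H2] := rb k B.
exists (C1 + C2) => s t x sB tB; rewrite mulrDr (le_trans (ler_normD _ _)) //.
by rewrite lerD ?H1 ?H2.
Qed.

Lemma rapid_mul a b : rapid a -> rapid b -> rapid (fun s t x => a s t x * b s t x).
Proof.
move=> ra rb k B; have [C1 _ H1] := rapid_bound k B ra.
have [C2 _ H2] := rapid_bound0 B rb.
by exists (C1 * C2) => s t x sB tB; rewrite mulrA normrM ler_pM ?H1 ?H2.
Qed.

Lemma rapid_scale r a : rapid a -> rapid (fun s t x => r * a s t x).
Proof.
move=> ra k B; have [C1 _ H1] := rapid_bound k B ra.
by exists (`|r| * C1) => s t x sB tB; rewrite mulrCA normrM ler_wpM2l ?H1.
Qed.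

Lemma time_primitiveP a s x : tcont a -> time_primitive a s 0 x = 0 /\
  forall t, is_derive t (1:R) (fun t => time_primitive a s t x) (a s t x).
Proof. by move=> ca; apply: primitiveP => t; exact: ca. Qed.

Lemma rapid_primitive a : rapid a -> tcont a -> rapid (time_primitive a).
Proof.
move=> ra ca k B; have [C _ HC] := rapid_bound k B ra.
exists (C * B) => s t x sB tB.
have [p0 dp] := time_primitiveP s x ca.
have B0 : 0 <= B by apply: le_trans tB.
have C0 : 0 <= C by apply: le_trans (HC s 0 0 sB _); rewrite ?normr0.
have := @mean_value_bound _ (fun t => x ^+ k * time_primitive a s t x) _ 0 t B C
  (fun t => is_deriveZ (x ^+ k) (dp t)).
rewrite p0 mulr0 !subr0 normr0 => /(_ B0 tB) W.
by rewrite (le_trans (W _)) ?ler_wpM2l // => y yB; exact: HC.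
Qed.

Lemma tcont_primitive a : tcont a -> tcont (time_primitive a).
Proof. by move=> ca s x t; exact: is_derive_continuous ((time_primitiveP s x ca).2 t). Qed.

Lemma lipschitz_add a b : lipschitz_sx a -> lipschitz_sx b ->
  lipschitz_sx (fun s t x => a s t x + b s t x).
Proof.
move=> la lb B; have [C1 H1] := la B; have [C2 H2] := lb B.
exists (C1 + C2) => s s' t x x' sB s'B tB.
have -> : a s' t x' + b s' t x' - (a s t x + b s t x) =
  (a s' t x' - a s t x) + (b s' t x' - b s t x) by ring.
by rewrite mulrDl (le_trans (ler_normD _ _)) // lerD ?H1 ?H2.
Qed.

Lemma lipschitz_mul a b : rapid a -> rapid b -> lipschitz_sx a -> lipschitz_sx b ->
  lipschitz_sx (fun s t x => a s t x * b s t x).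
Proof.
move=> ra rb la lb B.
have [C1 C10 H1] := lipschitz_sx_bound B la; have [C2 C20 H2] := lipschitz_sx_bound B lb.
have [D1 D10 K1] := rapid_bound0 B ra; have [D2 D20 K2] := rapid_bound0 B rb.
exists (C1 * D2 + D1 * C2) => s s' t x x' sB s'B tB.
have -> : a s' t x' * b s' t x' - a s t x * b s t x =
  (a s' t x' - a s t x) * b s' t x' + a s t x * (b s' t x' - b s t x) by ring.
rewrite [leRHS]mulrDl (le_trans (ler_normD _ _)) // !normrM lerD //.
  by rewrite mulrAC ler_pM ?H1 ?K2.
by rewrite -mulrA ler_pM ?K1 ?H2.
Qed.

Lemma lipschitz_scale r a : lipschitz_sx a -> lipschitz_sx (fun s t x => r * a s t x).
Proof.
move=> la B; have [C H] := la B; exists (`|r| * C) => s s' t x x' sB s'B tB.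
by rewrite -mulrBr normrM -mulrA ler_wpM2l ?H.
Qed.

Lemma time_primitive_diff a s s' x x' : tcont a -> forall t,
  is_derive t (1:R) (fun t => time_primitive a s' t x' - time_primitive a s t x)
    (a s' t x' - a s t x).
Proof.
move=> ca t.
exact: is_deriveB ((time_primitiveP s' x' ca).2 t) ((time_primitiveP s x ca).2 t).
Qed.

Lemma lipschitz_primitive a : tcont a -> lipschitz_sx a ->
  lipschitz_sx (time_primitive a).
Proof.
move=> ca la B; have [C C0 HC] := lipschitz_sx_bound B la.
exists (C * B) => s s' t x x' sB s'B tB.
have B0 : 0 <= B by apply: le_trans tB.
have := @mean_value_bound _ _ _ 0 t B (C * (`|s' - s| + `|x' - x|))
  (time_primitive_diff s s' x x' ca).
rewrite !(time_primitiveP _ _ ca).1 !subr0 normr0 => /(_ B0 tB) W.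
rewrite (le_trans (W _)) => [//|y yB|]; first exact: HC.
by rewrite mulrAC ler_wpM2r ?ler_wpM2l // addr_ge0.
Qed.

Lemma primitive_quad a b s s' x x' B D e : tcont a -> tcont b ->
  (forall t, `|t| <= B -> `|a s' t x' - a s t x - D * b s t x| <= e) ->
  forall t, `|t| <= B -> `|time_primitive a s' t x' - time_primitive a s t x
    - D * time_primitive b s t x| <= e * B.
Proof.
move=> ca cb H t tB.
have B0 : 0 <= B by apply: le_trans tB.
have e0 : 0 <= e by apply: le_trans (H 0 _); rewrite ?normr0.
have := @mean_value_bound _ (fun t => time_primitive a s' t x'
    - time_primitive a s t x - D * time_primitive b s t x)
  (fun t => a s' t x' - a s t x - D * b s t x) 0 t B e (fun t => is_deriveB
    (time_primitive_diff s s' x x' ca t)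
    (is_deriveZ D ((time_primitiveP s x cb).2 t))).
rewrite !(time_primitiveP _ _ ca).1 !(time_primitiveP _ _ cb).1.
rewrite mulr0 !subr0 normr0 => /(_ B0 tB H) W.
by rewrite (le_trans W) // ler_wpM2l.
Qed.

(** Differentiation under the integral: the mean value theorem and the Lipschitz bound of [b] give a
    quadratic remainder uniform in time, and integration multiplies it by at most [B]. *)
Lemma s_derivative_primitive a b : tcont a -> tcont b -> lipschitz_sx b ->
  s_derivative a b -> s_derivative (time_primitive a) (time_primitive b).
Proof.
move=> ca cb lb ab; apply: s_derivative_quad => B.
have [C C0 HC] := lipschitz_sx_bound B lb.
exists (C * B) => s s' t x sB s'B tB; rewrite mulrAC.
apply: (@primitive_quad a b s s' x x B) => // u uB.
have [th thP ->] := mean_value s s' (fun s => ab s u x).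
rewrite mulrC -mulrBr normrM -(real_normK (num_real (s' - s))) mulrC expr2 mulrA.
rewrite ler_wpM2r //.
apply: (le_trans (HC s _ u x x sB (norm_segment_le thP sB s'B) uB)).
rewrite subrr normr0 addr0 ler_wpM2l // [s + _]addrC addrK normrM.
have [t0 t1] := andP thP.
by rewrite (ger0_norm t0) ler_piMl.
Qed.

Lemma x_derivative_primitive a b : tcont a -> tcont b -> lipschitz_sx b ->
  x_derivative a b -> x_derivative (time_primitive a) (time_primitive b).
Proof.
move=> ca cb lb ab; apply: x_derivative_quad => B.
have [C C0 HC] := lipschitz_sx_bound B lb.
exists (C * B) => s t x x' sB tB; rewrite mulrAC.
apply: (@primitive_quad a b s s x x' B) => // u uB.
have [th thP ->] := mean_value x x' (ab s u).
rewrite mulrC -mulrBr normrM -(real_normK (num_real (x' - x))) mulrC expr2 mulrA.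
rewrite ler_wpM2r //.
apply: (le_trans (HC s s u x _ sB sB uB)).
rewrite subrr normr0 add0r ler_wpM2l // [x + _]addrC addrK normrM.
have [t0 t1] := andP thP.
by rewrite (ger0_norm t0) ler_piMl.
Qed.

(** Proved separately from the existence of derivatives, because the derivative of a primitive
    presupposes these estimates both for the integrand and for its derivative. *)
Lemma closure_estimates K :
  (forall a, K a -> [/\ rapid a, tcont a & lipschitz_sx a]) ->
  forall a, closure_of K a -> [/\ rapid a, tcont a & lipschitz_sx a].
Proof.
move=> HK a; elim=> {}a.
- by move=> /HK[].
- move=> Sa; split; [exact: schwartz_family_rapid|exact: schwartz_family_tcont|].
  exact: schwartz_family_lipschitz.
- move=> b _ [ra ca la] _ [rb cb lb]; split; first exact: rapid_add.
    by move=> s x t; apply: cvgD; [exact: ca|exact: cb].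
  exact: lipschitz_add.
- move=> b _ [ra ca la] _ [rb cb lb]; split; first exact: rapid_mul.
    by move=> s x t; apply: cvgM; [exact: ca|exact: cb].
  exact: lipschitz_mul.
- move=> b _ [rb cb lb]; split; first exact: rapid_scale.
    by move=> s x t; apply: cvgM; [exact: cvg_cst|exact: cb].
  exact: lipschitz_scale.
- move=> _ [ra ca la]; split; first exact: rapid_primitive.
    exact: tcont_primitive.
  exact: lipschitz_primitive.
Qed.

(** Coinduction up to closure: derivatives of generators need only fall into [closure_of K], which
    then serves as the invariant class. *)
Lemma schwartz_closure K :
  (forall a, K a -> [/\ rapid a, tcont a, lipschitz_sx a,
     exists2 b, closure_of K b & s_derivative a b
     & exists2 b, closure_of K b & x_derivative a b]) ->
  forall a, closure_of K a -> schwartz_family a.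
Proof.
move=> HK.
have H1 := @closure_estimates K (fun a Ka => let: And5 ra ca la _ _ := HK a Ka in And3 ra ca la).
move=> a Ka; exists (closure_of K) => // {a Ka} a Ka.
have [ra ca la] := H1 a Ka; split => //.
- elim: Ka {ra ca la} => {}a.
  + by move=> /HK[].
  + move=> Sa; exists (ds a); last exact: s_derivative_ds.
    by apply: closure_schwartz; exact: schwartz_family_ds.
  + move=> b _ [a' Ka' aa'] _ [b' Kb' bb'].
    exists (fun s t x => a' s t x + b' s t x); first exact: closure_add.
    by move=> s t x; exact: is_deriveD.
  + move=> b Ka [a' Ka' aa'] Kb [b' Kb' bb'].
    exists (fun s t x => a s t x * b' s t x + a' s t x * b s t x).
      by apply: closure_add; apply: closure_mul.
    by move=> s t x; exact: is_deriveM_fun (aa' s t x) (bb' s t x).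
  + move=> b Kb [b' Kb' bb']; exists (fun s t x => a * b' s t x).
      exact: closure_scale.
    by move=> s t x; exact: is_deriveZ.
  + move=> Ka [a' Ka' aa']; exists (time_primitive a'); first exact: closure_primitive.
    have [_ ca _] := H1 _ Ka; have [_ ca' la'] := H1 _ Ka'.
    exact: s_derivative_primitive.
- elim: Ka {ra ca la} => {}a.
  + by move=> /HK[].
  + move=> Sa; exists (dx a); last exact: x_derivative_dx.
    by apply: closure_schwartz; exact: schwartz_family_dx.
  + move=> b _ [a' Ka' aa'] _ [b' Kb' bb'].
    exists (fun s t x => a' s t x + b' s t x); first exact: closure_add.
    by move=> s t x; exact: is_deriveD.
  + move=> b Ka [a' Ka' aa'] Kb [b' Kb' bb'].
    exists (fun s t x => a s t x * b' s t x + a' s t x * b s t x).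
      by apply: closure_add; apply: closure_mul.
    by move=> s t x; exact: is_deriveM_fun (aa' s t x) (bb' s t x).
  + move=> b Kb [b' Kb' bb']; exists (fun s t x => a * b' s t x).
      exact: closure_scale.
    by move=> s t x; exact: is_deriveZ.
  + move=> Ka [a' Ka' aa']; exists (time_primitive a'); first exact: closure_primitive.
    have [_ ca _] := H1 _ Ka; have [_ ca' la'] := H1 _ Ka'.
    exact: x_derivative_primitive.
Qed.

End Families.

(** * Sums, quotients, composition and inversion of families *)

Section Operations.
Variable R : realType.
Local Notation fam := (R -> R -> R -> R).
Implicit Types (a b c f g phi : fam).

(** Without generators the closure consists of what is built from Schwartz families, and
    [schwartz_closure] leaves nothing to check. *)
Lemma schwartz_of_closure a : closure_of (fun _ => False) a -> schwartz_family a.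
Proof. by apply: schwartz_closure. Qed.

Lemma schwartz_add a b : schwartz_family a -> schwartz_family b ->
  schwartz_family (fun s t x => a s t x + b s t x).
Proof. by move=> ? ?; apply/schwartz_of_closure/closure_add; exact: closure_schwartz. Qed.

Lemma schwartz_scale r a : schwartz_family a ->
  schwartz_family (fun s t x => r * a s t x).
Proof. by move=> ?; apply/schwartz_of_closure/closure_scale; exact: closure_schwartz. Qed.

Definition bounded_below g := forall B, exists2 d, 0 < d &
  forall s t x, `|s| <= B -> `|t| <= B -> d <= 1 + g s t x.

Lemma bounded_below_neq0 g s t x : bounded_below g -> 0 < 1 + g s t x.
Proof.
move=> H; have [d d0 Hd] := H (`|s| + `|t|).
by rewrite (lt_le_trans d0) // Hd // ?lerDl ?lerDr.
Qed.

(** A reciprocal of [1 + g] does not decay, so it always keeps a numerator: the generators are the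
    quotients psi / (1 + g), and the quotient rule reads psi' / (1 + g) - (psi / (1 + g)) (g' / (1 +
    g)). *)
Lemma schwartz_div phi g : schwartz_family phi -> schwartz_family g ->
  bounded_below g -> schwartz_family (fun s t x => phi s t x / (1 + g s t x)).
Proof.
move=> Sphi Sg bg.
pose K a := exists2 psi, schwartz_family psi & a = fun s t x => psi s t x / (1 + g s t x).
have g0 s t x : 1 + g s t x != 0 by rewrite gt_eqF // bounded_below_neq0.
suff HK a : closure_of K a -> schwartz_family a.
  by apply: HK; apply: closure_base; exists phi.
apply: schwartz_closure => {}a [psi Spsi ->]; split.
- move=> k B; have [C C0 HC] := rapid_bound k B (schwartz_family_rapid Spsi).
  have [d d0 Hd] := bg B; exists (C / d) => s t x sB tB.
  rewrite mulrA normrM ler_pM //; first exact: HC.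
  have Hx := Hd s t x sB tB; have p0 := lt_le_trans d0 Hx.
  by rewrite normfV gtr0_norm // lef_pV2 // posrE.
- move=> s x t; apply: cvgM; first exact: (schwartz_family_tcont Spsi).
  apply: cvgV => //; apply: cvgD; first exact: cvg_cst.
  exact: (schwartz_family_tcont Sg).
- move=> B.
  have [C1 C10 H1] := lipschitz_sx_bound B (schwartz_family_lipschitz Spsi).
  have [C2 C20 H2] := lipschitz_sx_bound B (schwartz_family_lipschitz Sg).
  have [D1 D10 K1] := rapid_bound0 B (schwartz_family_rapid Spsi).
  have [d d0 Hd] := bg B; exists (C1 / d + D1 * C2 / (d * d)).
  move=> s s' t x x' sB s'B tB.
  have P1 := lt_le_trans d0 (Hd s t x sB tB).
  have P2 := lt_le_trans d0 (Hd s' t x' s'B tB).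
  have -> : psi s' t x' / (1 + g s' t x') - psi s t x / (1 + g s t x) =
    (psi s' t x' - psi s t x) / (1 + g s' t x') -
    psi s t x * (g s' t x' - g s t x) / ((1 + g s t x) * (1 + g s' t x')).
    by field; rewrite !g0.
  rewrite [leRHS]mulrDl (le_trans (ler_normB _ _)) // lerD //.
    rewrite normrM mulrAC ler_pM ?H1 // normfV gtr0_norm // lef_pV2 ?posrE //.
    exact: Hd.
  rewrite normrM [leRHS]mulrAC ler_pM //.
    by rewrite normrM -mulrA ler_pM ?K1 ?H2.
  rewrite normfV gtr0_norm ?mulr_gt0 // lef_pV2 ?posrE ?mulr_gt0 //.
  by rewrite ler_pM ?(ltW d0) // Hd.
- exists (fun s t x => ds psi s t x / (1 + g s t x) +
    -1 * ((psi s t x / (1 + g s t x)) * (ds g s t x / (1 + g s t x)))).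
    apply: closure_add; first by apply: closure_base; exists (ds psi) => //;
      exact: schwartz_family_ds.
    apply: closure_scale; apply: closure_mul; apply: closure_base; [by exists psi|].
    by exists (ds g) => //; exact: schwartz_family_ds.
  move=> s t x.
  have D1 : is_derive s (1:R) (fun s => 1 + g s t x) (ds g s t x).
    by apply: is_derive_addl; exact: s_derivative_ds.
  have := is_deriveM_fun (s_derivative_ds Spsi s t x)
    (@is_deriveV R (fun s => 1 + g s t x) s _ 1 (g0 s t x) D1).
  congr is_derive; rewrite /GRing.scale /=; field; exact: g0.
- exists (fun s t x => dx psi s t x / (1 + g s t x) +
    -1 * ((psi s t x / (1 + g s t x)) * (dx g s t x / (1 + g s t x)))).
    apply: closure_add; first by apply: closure_base; exists (dx psi) => //;
      exact: schwartz_family_dx.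
    apply: closure_scale; apply: closure_mul; apply: closure_base; [by exists psi|].
    by exists (dx g) => //; exact: schwartz_family_dx.
  move=> s t x.
  have D1 : is_derive x (1:R) (fun x => 1 + g s t x) (dx g s t x).
    by apply: is_derive_addl; exact: x_derivative_dx.
  have := is_deriveM_fun (x_derivative_dx Spsi s t x)
    (@is_deriveV R (fun x => 1 + g s t x) x _ 1 (g0 s t x) D1).
  congr is_derive; rewrite /GRing.scale /=; field; exact: g0.
Qed.

Definition shift_comp phi g : fam := fun s t x => phi s t (x + g s t x).

Definition bounded_family g := forall B, exists2 C, 0 <= C &
  forall s t x, `|s| <= B -> `|t| <= B -> `|g s t x| <= C.

Lemma exprD_le (u v : R) k : 0 <= u -> 0 <= v ->
  (u + v) ^+ k <= 2 ^+ k * (u ^+ k + v ^+ k).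
Proof.
move=> u0 v0; wlog uv : u v u0 v0 / v <= u.
  move=> H; have [vu|uv] := leP v u; first exact: H.
  by rewrite addrC [u ^+ k + _]addrC H // ltW.
apply: (@le_trans _ _ ((2 * u) ^+ k)).
  by rewrite lerXn2r ?nnegrE ?addr_ge0 ?mulr_ge0 // mulr_natl mulr2n lerD2l.
by rewrite exprMn ler_wpM2l ?exprn_ge0 // lerDl exprn_ge0.
Qed.

(** A bounded displacement lets |x| be compared with |x + g| + G, and with it the weights at the two
    points. *)
Lemma shift_comp_rapid phi g : rapid phi -> bounded_family g -> rapid (shift_comp phi g).
Proof.
move=> rphi bg k B; have [C C0 HC] := rapid_bound k B rphi.
have [D D0 HD] := rapid_bound0 B rphi; have [G G0 HG] := bg B.
exists (2 ^+ k * (C + G ^+ k * D)) => s t x sB tB; rewrite /shift_comp.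
set y := x + g s t x.
have xy : `|x| <= `|y| + G.
  have -> : x = y - g s t x by rewrite /y; ring.
  by rewrite (le_trans (ler_normB _ _)) // lerD2l HG.
rewrite normrM normrX (@le_trans _ _ ((`|y| + G) ^+ k * `|phi s t y|)) //.
  by rewrite ler_wpM2r // lerXn2r // nnegrE addr_ge0.
apply: (@le_trans _ _ (2 ^+ k * (`|y| ^+ k + G ^+ k) * `|phi s t y|)).
  by rewrite ler_wpM2r // exprD_le.
rewrite -mulrA ler_wpM2l ?exprn_ge0 // mulrDl lerD //.
  by rewrite -normrX -normrM HC.
by rewrite ler_wpM2l ?exprn_ge0 // HD.
Qed.

Lemma shift_comp_lipschitz phi g : lipschitz_sx phi -> lipschitz_sx g ->
  lipschitz_sx (shift_comp phi g).
Proof.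
move=> lphi lg B; have [C C0 HC] := lipschitz_sx_bound B lphi.
have [D D0 HD] := lipschitz_sx_bound B lg.
exists (C * (1 + D)) => s s' t x x' sB s'B tB.
apply: (le_trans (HC _ _ _ _ _ sB s'B tB)); rewrite -mulrA ler_wpM2l //.
have -> : x' + g s' t x' - (x + g s t x) = (x' - x) + (g s' t x' - g s t x) by ring.
have := HD s s' t x x' sB s'B tB; have := ler_normD (x' - x) (g s' t x' - g s t x).
by rewrite mulrDl mul1r; lra.
Qed.

Lemma shift_comp_tcont phi g : tcont phi -> lipschitz_sx phi -> tcont g ->
  tcont (shift_comp phi g).
Proof.
move=> cphi lphi cg s x.
apply: (@continuous_time_dependent _ (phi s) (fun t => x + g s t x)).
- by move=> z t; exact: cphi.
- move=> B; have [C C0 HC] := lipschitz_sx_bound (`|s| + B) lphi.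
  exists C => t y z tB.
  have B0 : 0 <= B by apply: le_trans tB.
  have := HC s s t z y; rewrite subrr normr0 add0r; apply; rewrite ?lerDl //.
  by rewrite (le_trans tB) // lerDr.
- move=> t; apply: cvgD; first exact: cvg_cst.
  exact: cg.
Qed.

Lemma shift_comp_s_derivative phi g gs : schwartz_family phi -> lipschitz_sx g ->
  s_derivative g gs -> s_derivative (shift_comp phi g)
    (fun s t x => shift_comp (ds phi) g s t x + shift_comp (dx phi) g s t x * gs s t x).
Proof.
move=> Sphi lg dg s t x.
(* Of [g] only a derivative and a Lipschitz bound are available. Splitting off the term linear in
   [g] leaves a function with quadratic remainder, by the Taylor estimate for [phi]. *)
have Q : is_derive s (1:R) (fun s' => shift_comp phi g s' t x
    - shift_comp (dx phi) g s t x * g s' t x) (shift_comp (ds phi) g s t x).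
  set B := `|s| + `|t| + 1.
  have [C C0 HC] := schwartz_family_taylor Sphi B.
  have [D D0 HD] := lipschitz_sx_bound B lg.
  apply: (@is_derive_quad _ _ _ _ (C * (1 + D) ^+ 2) 1) => // h h1.
  have sB : `|s| <= B by rewrite /B; have := normr_ge0 t; lra.
  have tB : `|t| <= B by rewrite /B; have := normr_ge0 s; lra.
  have s'B : `|s + h| <= B.
    by rewrite (le_trans (ler_normD _ _)) // /B; have := normr_ge0 t; lra.
  have T := HC s (s + h) t (x + g s t x) (x + g (s + h) t x) sB s'B tB.
  have L := HD s (s + h) t x x sB s'B tB.
  rewrite subrr normr0 addr0 [s + h - s]addrC addKr in L.
  rewrite [s + h - s]addrC addKr in T.
  have E : x + g (s + h) t x - (x + g s t x) = g (s + h) t x - g s t x by ring.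
  rewrite E in T; rewrite /shift_comp; move: T; set U := (X in `|X| <= _) => T.
  rewrite [X in `|X|](_ : _ = U); last by rewrite /U; ring.
  apply: (le_trans T); rewrite -mulrA ler_wpM2l // -(real_normK (num_real h)) -exprMn.
  rewrite lerXn2r ?nnegrE ?addr_ge0 ?mulr_ge0 ?addr_ge0 //.
  by rewrite mulrDl mul1r lerD2l.
have := is_deriveD Q (is_deriveZ (shift_comp (dx phi) g s t x) (dg s t x)).
by apply: is_derive_ext => s'; rewrite !fctE /GRing.scale /= subrK.
Qed.

Lemma shift_comp_x_derivative phi g gx : schwartz_family phi -> lipschitz_sx g ->
  x_derivative g gx -> x_derivative (shift_comp phi g)
    (fun s t x => shift_comp (dx phi) g s t x + shift_comp (dx phi) g s t x * gx s t x).
Proof.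
move=> Sphi lg dg s t x; rewrite -[X in X + _]mulr1 -mulrDr.
apply: (@is_derive_comp_fun _ (phi s t) (fun x => x + g s t x)).
  exact: is_deriveD.
exact: x_derivative_dx.
Qed.

Lemma schwartz_shift_comp phi g : schwartz_family phi -> schwartz_family g ->
  schwartz_family (shift_comp phi g).
Proof.
move=> Sphi Sg.
pose K a := exists2 psi, schwartz_family psi & a = shift_comp psi g.
have lg := schwartz_family_lipschitz Sg.
suff HK a : closure_of K a -> schwartz_family a.
  by apply: HK; apply: closure_base; exists phi.
apply: schwartz_closure => {}a [psi Spsi ->].
have Kds : closure_of K (shift_comp (ds psi) g).
  by apply: closure_base; exists (ds psi) => //; exact: schwartz_family_ds.
have Kdx : closure_of K (shift_comp (dx psi) g).
  by apply: closure_base; exists (dx psi) => //; exact: schwartz_family_dx.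
split.
- apply: shift_comp_rapid; first exact: schwartz_family_rapid.
  by move=> B; apply: rapid_bound0; exact: schwartz_family_rapid.
- apply: shift_comp_tcont; [exact: schwartz_family_tcont
    |exact: schwartz_family_lipschitz|exact: schwartz_family_tcont].
- by apply: shift_comp_lipschitz => //; exact: schwartz_family_lipschitz.
- exists (fun s t x => shift_comp (ds psi) g s t x
    + shift_comp (dx psi) g s t x * ds g s t x).
    apply: closure_add => //; apply: closure_mul => //.
    by apply: closure_schwartz; exact: schwartz_family_ds.
  by apply: shift_comp_s_derivative => //; exact: s_derivative_ds.
- exists (fun s t x => shift_comp (dx psi) g s t x
    + shift_comp (dx psi) g s t x * dx g s t x).
    apply: closure_add => //; apply: closure_mul => //.
    by apply: closure_schwartz; exact: schwartz_family_dx.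
  by apply: shift_comp_x_derivative => //; exact: x_derivative_dx.
Qed.

(** [Id + g] is the right inverse of [Id + f], and all regularity of [g] is extracted from this
    equation. The derivatives are those of the implicit function theorem, composed with [Id + g]. *)
Lemma schwartz_inverse f g : schwartz_family f -> bounded_below (dx f) ->
  (forall s t x, g s t x + shift_comp f g s t x = 0) -> schwartz_family g.
Proof.
move=> Sf bf fg.
have Sdx := schwartz_family_dx Sf; have Sds := schwartz_family_ds Sf.
have f0 s t x : 1 + dx f s t x != 0 by rewrite gt_eqF // bounded_below_neq0.
have gE s t x : g s t x = - f s t (x + g s t x).
  by apply/eqP; rewrite -subr_eq0 opprK; apply/eqP; exact: fg.
have bg : bounded_family g.
  move=> B; have [C C0 HC] := rapid_bound0 B (schwartz_family_rapid Sf).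
  by exists C => // s t x sB tB; rewrite gE normrN HC.
(* Since 1 + f_x is bounded away from 0, z + f(z) controls z. This gives the Lipschitz bound and the
   time continuity of [g]. *)
have below (B : R) : exists2 d : R, 0 < d & forall s t z z', `|s| <= B -> `|t| <= B ->
    `|z' - z| <= d * `|z' - z + (f s t z' - f s t z)|.
  have [d d0 Hd] := bf B; exists d^-1; first by rewrite invr_gt0.
  move=> s t z z' sB tB.
  have [th _ ->] := mean_value z z' (x_derivative_dx Sf s t).
  rewrite -{2}[z' - z]mul1r -mulrDl normrM mulrA ler_peMl //.
  rewrite -(@ler_pM2l _ d) // mulr1 mulrA divff ?gt_eqF // mul1r.
  exact: le_trans (Hd s t _ sB tB) (ler_norm _).
have lg : lipschitz_sx g.
  move=> B; have [C C0 HC] := lipschitz_sx_bound B (schwartz_family_lipschitz Sf).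
  have [d d0 Hd] := below B.
  exists (d * (1 + C) + 1) => s s' t x x' sB s'B tB.
  have := Hd s' t (x + g s t x) (x' + g s' t x') s'B tB.
  set z := x + g s t x; set z' := x' + g s' t x'.
  (* Uses that z + f_s(z) = x and z' + f_{s'}(z') = x'. *)
  have -> : z' - z + (f s' t z' - f s' t z) = (x' - x) - (f s' t z - f s t z).
    have zE : z = x - f s t z by rewrite {1}/z gE.
    have zE' : z' = x' - f s' t z' by rewrite {1}/z' gE.
    by rewrite {1}zE' {1}zE; ring.
  have -> : g s' t x' - g s t x = (z' - z) - (x' - x) by rewrite /z /z'; ring.
  have := HC s s' t z z sB s'B tB; rewrite subrr normr0 addr0 => H1 H2.
  have H3 := ler_normB (x' - x) (f s' t z - f s t z).
  apply: (le_trans (ler_normB _ _)).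
  have H4 : d * `|x' - x - (f s' t z - f s t z)| <= d * (`|x' - x| + C * `|s' - s|).
    by rewrite ler_pM2l // (le_trans H3) // lerD2l.
  have p0 := normr_ge0 (x' - x); have q0 := normr_ge0 (s' - s).
  have := mulr_ge0 (ltW d0) q0; have := mulr_ge0 (mulr_ge0 (ltW d0) C0) p0; nra.
have cg : tcont g.
  move=> s x t; apply/continuousP_eps => e e0.
  have [d d0 Hd] := below (`|s| + `|t| + 1).
  have cf : tcont f by exact: schwartz_family_tcont.
  have [r r0 Hr] := iffLR (continuousP_eps _ _) (cf s (x + g s t x) t) _ (divr_gt0 e0 d0).
  exists (Num.min 1 r); first by rewrite lt_min ltr01.
  move=> t'; rewrite lt_min => /andP[t1 tr].
  have := Hd s t' (x + g s t x) (x + g s t' x).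
  set z := x + g s t x; set z' := x + g s t' x.
  have -> : z' - z = g s t' x - g s t x by rewrite /z /z'; ring.
  have -> : g s t' x - g s t x + (f s t' z' - f s t' z) = - (f s t' z - f s t z).
    have zE : g s t x = - f s t z by rewrite {1}gE.
    have zE' : g s t' x = - f s t' z' by rewrite {1}gE.
    by rewrite zE' zE; ring.
  move=> W; rewrite (le_trans (W _ _)) //.
  - by have := normr_ge0 t; lra.
  - have := ler_normD (t' - t) t; rewrite subrK.
    by have := normr_ge0 s; lra.
  - by rewrite normrN mulrC -ler_pdivlMr // Hr.
pose K a := exists2 psi, schwartz_family psi & a = shift_comp psi g.
have Kpsi psi : schwartz_family psi -> closure_of K (shift_comp psi g).
  by move=> Spsi; apply: closure_base; exists psi.
pose qs s t x := -1 * (ds f s t x / (1 + dx f s t x)).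
pose qx s t x := -1 * (dx f s t x / (1 + dx f s t x)).
have Sqs : schwartz_family qs by apply: schwartz_scale; exact: schwartz_div.
have Sqx : schwartz_family qx by apply: schwartz_scale; exact: schwartz_div.
(* The Taylor expansion of [f] between the points z and z' is an equation for the increment of [g];
   solving it divides the remainder by -(1 + f_x). *)
have taylor (B : R) : exists C : R, forall s s' t x x', `|s| <= B -> `|s'| <= B -> `|t| <= B ->
    `|g s' t x' - g s t x - ((s' - s) * shift_comp qs g s t x
      + (x' - x) * shift_comp qx g s t x)| <= C * (`|s' - s| + `|x' - x|) ^+ 2.
  have [C C0 HC] := schwartz_family_taylor Sf B; have [D D0 HD] := lipschitz_sx_bound B lg.
  have [d d0 Hd] := bf B.
  exists (d^-1 * (C * (1 + D) ^+ 2)) => s s' t x x' sB s'B tB.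
  have := HC s s' t (x + g s t x) (x' + g s' t x') sB s'B tB.
  rewrite /shift_comp /qs /qx; have := f0 s t (x + g s t x).
  have := Hd s t (x + g s t x) sB tB.
  set F := dx f s t _; set G := ds f s t _ => dF F0.
  set rem := (X in `|X| <= _) => T.
  have -> : g s' t x' - g s t x - ((s' - s) * (-1 * (G / (1 + F)))
      + (x' - x) * (-1 * (F / (1 + F)))) = - ((1 + F)^-1 * rem).
    have r2 : rem = - g s' t x' + g s t x - ((s' - s) * G
        + ((x' - x) + (g s' t x' - g s t x)) * F).
      have fE u w : f u t (w + g u t w) = - g u t w by rewrite [in RHS]gE opprK.
      by rewrite /rem !fE; ring.
    by rewrite r2; field.
  rewrite normrN normrM -[leRHS]mulrA; apply: ler_pM => //.
    have F1 := lt_le_trans d0 dF.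
    by rewrite normfV gtr0_norm // lef_pV2 // posrE.
  apply: (le_trans T); rewrite -mulrA ler_wpM2l // -exprMn.
  rewrite lerXn2r ?nnegrE ?mulr_ge0 ?addr_ge0 //.
  have := HD s s' t x x' sB s'B tB => L.
  have E : x' + g s' t x' - (x + g s t x) = (x' - x) + (g s' t x' - g s t x) by ring.
  have := ler_normD (x' - x) (g s' t x' - g s t x); rewrite -E.
  by rewrite mulrDl mul1r; lra.
have dgs : s_derivative g (shift_comp qs g).
  apply: s_derivative_quad => B; have [C HC] := taylor B.
  exists C => s s' t x sB s'B tB; have := HC s s' t x x sB s'B tB.
  by rewrite subrr normr0 !addr0 mul0r addr0 real_normK ?num_real.
have dgx : x_derivative g (shift_comp qx g).
  apply: x_derivative_quad => B; have [C HC] := taylor B.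
  exists C => s t x x' sB tB; have := HC s s t x x' sB sB tB.
  by rewrite subrr normr0 !add0r mul0r add0r real_normK ?num_real.
suff HK a : closure_of K a -> schwartz_family a.
  apply: HK.
  (* The equation itself places [g] in the closure of the compositions with [Id + g]. *)
  have -> : g = fun s t x => -1 * shift_comp f g s t x.
    by do 3 apply/funext => ?; rewrite mulN1r; exact: gE.
  by apply: closure_scale; exact: Kpsi.
apply: schwartz_closure => {}a [psi Spsi ->].
have Spds := schwartz_family_ds Spsi; have Spdx := schwartz_family_dx Spsi.
split.
- by apply: shift_comp_rapid => //; exact: schwartz_family_rapid.
- apply: shift_comp_tcont => //; first exact: schwartz_family_tcont.
  exact: schwartz_family_lipschitz.
- by apply: shift_comp_lipschitz => //; exact: schwartz_family_lipschitz.
- exists (fun s t x => shift_comp (ds psi) g s t x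
    + shift_comp (dx psi) g s t x * shift_comp qs g s t x).
    by apply: closure_add; [|apply: closure_mul]; exact: Kpsi.
  exact: shift_comp_s_derivative.
- exists (fun s t x => shift_comp (dx psi) g s t x
    + shift_comp (dx psi) g s t x * shift_comp qx g s t x).
    by apply: closure_add; [|apply: closure_mul]; exact: Kpsi.
  exact: shift_comp_x_derivative.
Qed.

End Operations.

(** * Flows of time-dependent fields with a parameter *)

Section Flow.
Variable R : realType.
Local Notation fam := (R -> R -> R -> R).
Implicit Types (a b c f g phi : fam).

(** With E the exponential, B E <= (1 + B E)^2 removes the squares without a square root. *)
Lemma gronwall_norm (r dr : R -> R) (B L e : R) : 0 <= L -> 0 <= B -> 0 <= e ->
  (forall y, is_derive y (1:R) r (dr y)) -> r 0 = 0 ->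
  (forall y, `|y| <= B -> `|dr y| <= L * `|r y| + e) ->
  forall t, `|t| <= B -> `|r t| <= e * (1 + B * expR ((2 * L + 1) * B)).
Proof.
move=> L0 B0 e0 Hr r0 H t tB.
have := gronwall L0 B0 Hr r0 H tB; set E := expR _ => W.
have E0 : 0 <= B * E by rewrite mulr_ge0 ?expR_ge0.
rewrite -(@ler_pXn2r _ 2) ?nnegrE ?mulr_ge0 ?addr_ge0 // real_normK ?num_real //.
apply: (le_trans W); rewrite exprMn -mulrA ler_wpM2l ?sqr_ge0 //.
by have := sqr_ge0 (B * E); nra.
Qed.

Lemma expRB1_le (y C : R) : `|y| <= C -> `|expR y - 1| <= expR C * `|y|.
Proof.
move=> yC; have := @mean_value_bound R expR expR 0 y C (expR C)
  (fun z => is_derive_expR z).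
rewrite expR0 subr0 normr0; apply => //; first by apply: le_trans yC.
by move=> z zC; rewrite ger0_norm ?expR_ge0 // ler_expR (le_trans (ler_norm z)).
Qed.

Section FlowOfField.
Local Opaque time_primitive expR.
Variables (a e : fam).
Hypothesis Sa : schwartz_family a.
Hypothesis e0 : forall s x, e s 0 x = 0.
Hypothesis eE : forall s x t, is_derive t (1:R) (fun t => e s t x) (shift_comp a e s t x).

Let ax := shift_comp (dx a) e.
Let as_ := shift_comp (ds a) e.
Let I := time_primitive ax.
(** [I] decays in x, so the exponential tends to 1; subtracting 1 makes it a rapid family. *)
Definition exp_primitive (r : R) : fam := fun s t x => expR (r * I s t x) - 1.
Let J := exp_primitive.

(** Duhamel's formula exp(I) times the primitive of exp(-I) w for the solution of v' = w + a_x v,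
    v(0) = 0, with each exponential written as 1 plus a decaying term. *)
Definition variation (w : fam) : fam :=
  let P := time_primitive (fun s t x => w s t x + w s t x * J (-1) s t x) in
  fun s t x => P s t x + J 1 s t x * P s t x.

Lemma flow_bounded : bounded_family e.
Proof.
move=> B; have [C C0 HC] := rapid_bound0 B (schwartz_family_rapid Sa).
exists (C * `|B|) => [|s t x sB tB]; first by rewrite mulr_ge0.
have B0 : 0 <= B by apply: le_trans tB.
rewrite (ger0_norm B0).
have := @mean_value_bound _ _ _ 0 t B C (eE s x).
rewrite e0 !subr0 normr0 => /(_ B0 tB) W.
rewrite (le_trans (W _)) ?ler_wpM2l // => y yB; exact: HC.
Qed.

Lemma flow_tcont : tcont e.
Proof. by move=> s x t; exact: is_derive_continuous (eE s x t). Qed.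

Lemma flow_lipschitz : lipschitz_sx e.
Proof.
move=> B; have [C C0 HC] := lipschitz_sx_bound B (schwartz_family_lipschitz Sa).
exists (C * (1 + B * expR ((2 * C + 1) * B))) => s s' t x x' sB s'B tB.
have B0 : 0 <= B by apply: le_trans tB.
rewrite mulrAC.
apply: (@gronwall_norm (fun t => e s' t x' - e s t x) _ B C _ C0 B0 _
  (fun t => is_deriveB (eE s' x' t) (eE s x t))) => //.
- by rewrite mulr_ge0 ?addr_ge0.
- by rewrite !e0 subrr.
move=> y yB; apply: (le_trans (HC _ _ _ _ _ sB s'B yB)); rewrite -mulrDr ler_wpM2l //.
have -> : x' + e s' y x' - (x + e s y x) = (x' - x) + (e s' y x' - e s y x) by ring.
by have := ler_normD (x' - x) (e s' y x' - e s y x); lra.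
Qed.

Lemma shift_flow_estimates phi : schwartz_family phi ->
  [/\ rapid (shift_comp phi e), tcont (shift_comp phi e) & lipschitz_sx (shift_comp phi e)].
Proof.
move=> Sphi; split.
- apply: shift_comp_rapid; [exact: schwartz_family_rapid|exact: flow_bounded].
- apply: shift_comp_tcont; [exact: schwartz_family_tcont
    |exact: schwartz_family_lipschitz|exact: flow_tcont].
- apply: shift_comp_lipschitz; [exact: schwartz_family_lipschitz|exact: flow_lipschitz].
Qed.

Let ax_estimates := shift_flow_estimates (schwartz_family_dx Sa).
Let cax : tcont ax. Proof. by case: ax_estimates. Qed.

Lemma exp_primitive_estimates r : [/\ rapid (J r), tcont (J r) & lipschitz_sx (J r)].
Proof.
have [rax _ lax] := ax_estimates.
have rI : rapid I by exact: rapid_primitive.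
have cI : tcont I by exact: tcont_primitive.
have lI : lipschitz_sx I by exact: lipschitz_primitive.
split.
- move=> k B; have [C C0 HC] := rapid_bound k B rI; have [D D0 HD] := rapid_bound0 B rI.
  exists (expR (`|r| * D) * (`|r| * C)) => s t x sB tB.
  have rD : `|r * I s t x| <= `|r| * D by rewrite normrM ler_wpM2l ?HD.
  rewrite normrM (@le_trans _ _ (`|x ^+ k| * (expR (`|r| * D) * `|r * I s t x|))) //.
    by rewrite ler_wpM2l // expRB1_le.
  by rewrite mulrCA ler_wpM2l ?expR_ge0 // normrM mulrCA -normrM ler_wpM2l // HC.
- move=> s x t; apply: cvgB; last exact: cvg_cst.
  apply: (@continuous_comp _ _ _ (fun t => r * I s t x) expR).
    by apply: cvgM; [exact: cvg_cst|exact: cI].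
  exact: continuous_expR.
- move=> B; have [C C0 HC] := lipschitz_sx_bound B lI.
  have [D D0 HD] := rapid_bound0 B rI.
  exists (expR (`|r| * D) * (`|r| * C)) => s s' t x x' sB s'B tB.
  have rD s1 x1 : `|s1| <= B -> `|r * I s1 t x1| <= `|r| * D.
    by move=> s1B; rewrite normrM ler_wpM2l ?HD.
  rewrite /J /exp_primitive.
  have -> : expR (r * I s' t x') - 1 - (expR (r * I s t x) - 1) =
     expR (r * I s' t x') - expR (r * I s t x) by rewrite opprB addrA subrK.
  apply: (le_trans (@mean_value_bound _ expR expR (r * I s t x) (r * I s' t x')
    (`|r| * D) (expR (`|r| * D)) (fun z => is_derive_expR z) (rD _ _ sB) (rD _ _ s'B) _)).
    by move=> z zC; rewrite ger0_norm ?expR_ge0 // ler_expR (le_trans (ler_norm z)).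
  rewrite -[leRHS]mulrA ler_wpM2l ?expR_ge0 //.
  by rewrite -mulrBr normrM -mulrA ler_wpM2l // HC.
Qed.

Lemma variationP w s x : tcont w -> variation w s 0 x = 0 /\
  forall t, is_derive t (1:R) (fun t => variation w s t x)
    (w s t x + ax s t x * variation w s t x).
Proof.
move=> cw; have [_ cJ _] := exp_primitive_estimates (-1).
have cP : tcont (fun s t x => w s t x + w s t x * J (-1) s t x).
  by move=> s1 x1 t1; apply: cvgD; [exact: cw|apply: cvgM; [exact: cw|exact: cJ]].
have [P0 dP] := time_primitiveP s x cP; have [_ dI] := time_primitiveP s x cax.
split; first by rewrite /variation P0 mulr0 addr0.
move=> t; set P := time_primitive _ in P0 dP.
have dJ : is_derive t (1:R) (fun t => expR (1 * I s t x)) (expR (1 * I s t x) * ax s t x).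
  apply: (@is_derive_comp_fun _ expR (fun t => 1 * I s t x)).
    by apply: (is_derive_ext _ (dI t)) => y; rewrite mul1r.
have := is_deriveM_fun dJ (dP t).
rewrite [X in is_derive _ _ _ X -> _](_ : _ = w s t x + ax s t x * variation w s t x).
  by apply: is_derive_ext => y; rewrite /variation -/P /J /exp_primitive; ring.
rewrite /variation -/P /J /exp_primitive mulN1r expRN mul1r.
by field; rewrite gt_eqF // expR_gt0.
Qed.

(** The remainder solves r' = a_x r + q, where q is the Taylor remainder of [a] between the two
    trajectories. By [flow_lipschitz] q is quadratic in the increments, and Gronwall passes this on
    to r. *)
Lemma flow_taylor B : exists C : R, forall s s' t x x',
  `|s| <= B -> `|s'| <= B -> `|t| <= B ->
  `|e s' t x' - e s t x - ((s' - s) * variation as_ s t x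
    + (x' - x) * variation ax s t x)| <= C * (`|s' - s| + `|x' - x|) ^+ 2.
Proof.
have [_ cas _] := shift_flow_estimates (schwartz_family_ds Sa).
have [C C0 HC] := schwartz_family_taylor Sa B.
have [D D0 HD] := lipschitz_sx_bound B flow_lipschitz.
have [rax _ _] := ax_estimates; have [L L0 HL] := rapid_bound0 B rax.
exists (C * (1 + D) ^+ 2 * (1 + B * expR ((2 * L + 1) * B))) => s s' t x x' sB s'B tB.
have B0 : 0 <= B by apply: le_trans tB.
rewrite mulrAC.
have [vs0 dvs] := variationP s x cas; have [vx0 dvx] := variationP s x cax.
apply: (@gronwall_norm (fun t => e s' t x' - e s t x - ((s' - s) * variation as_ s t x
    + (x' - x) * variation ax s t x)) _ B L _ L0 B0 _
  (fun t => is_deriveB (is_deriveB (eE s' x' t) (eE s x t))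
    (is_deriveD (is_deriveZ (s' - s) (dvs t)) (is_deriveZ (x' - x) (dvx t))))) => //.
- by rewrite !mulr_ge0 ?exprn_ge0 ?addr_ge0.
- by rewrite !e0 vs0 vx0; ring.
move=> y yB; rewrite /GRing.scale /=.
have T := HC s s' y (x + e s y x) (x' + e s' y x') sB s'B yB.
have E : x' + e s' y x' - (x + e s y x) = (x' - x) + (e s' y x' - e s y x) by ring.
have Lx := HD s s' y x x' sB s'B yB.
rewrite E in T.
set u := e s' y x' - e s y x in T Lx *.
set vs := variation as_ s y x; set vx := variation ax s y x.
have -> : shift_comp a e s' y x' - shift_comp a e s y x
   - ((s' - s) * (as_ s y x + ax s y x * vs) + (x' - x) * (ax s y x + ax s y x * vx)) =
   (ax s y x * (u - ((s' - s) * vs + (x' - x) * vx))) +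
   (a s' y (x' + e s' y x') - a s y (x + e s y x)
     - ((s' - s) * ds a s y (x + e s y x) + (x' - x + u) * dx a s y (x + e s y x))).
  by rewrite /ax /as_ /shift_comp; ring.
rewrite (le_trans (ler_normD _ _)) // lerD //.
  by rewrite normrM ler_wpM2r // HL.
apply: (le_trans T); rewrite -mulrA ler_wpM2l // -exprMn.
rewrite lerXn2r ?nnegrE ?mulr_ge0 ?addr_ge0 //.
rewrite mulrDl mul1r (le_trans (lerD (lexx _) (ler_normD (x' - x) u))) //.
by rewrite addrA lerD2l.
Qed.

Lemma flow_s_derivative : s_derivative e (variation as_).
Proof.
apply: s_derivative_quad => B; have [C HC] := flow_taylor B.
exists C => s s' t x sB s'B tB; have := HC s s' t x x sB s'B tB.
by rewrite subrr normr0 !addr0 mul0r addr0 real_normK ?num_real.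
Qed.

Lemma flow_x_derivative : x_derivative e (variation ax).
Proof.
apply: x_derivative_quad => B; have [C HC] := flow_taylor B.
exists C => s t x x' sB tB; have := HC s s t x x' sB sB tB.
by rewrite subrr normr0 !add0r mul0r add0r real_normK ?num_real.
Qed.

(** Both [1 + variation ax] and exp(I) solve v' = a_x v with v = 1 at time 0. Hence x + e has
    derivative exp(I) > 0, which is the orientation condition. *)
Lemma variation_ax : variation ax = J 1.
Proof.
apply/funext => s; apply/funext => t; apply/funext => x.
have [v0 dv] := variationP s x cax.
have [I0 dI] : I s 0 x = 0 /\ _ := time_primitiveP s x cax.
pose h t := expR (-1 * I s t x) * (1 + variation ax s t x).
have dh t' : is_derive t' (1:R) h 0.
  have d1 : is_derive t' (1:R) (fun t => expR (-1 * I s t x))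
      (expR (-1 * I s t' x) * (-1 * ax s t' x)).
    exact: (@is_derive_comp_fun _ expR (fun t => -1 * I s t x)).
  have := is_deriveM_fun d1 (is_derive_addl 1 (dv t')).
  by congr is_derive; ring.
have := is_derive_0_is_cst t 0 dh.
rewrite /h v0 I0 mulr0 expR0 mul1r addr0 mulN1r expRN => E.
rewrite /J /exp_primitive mul1r.
have -> : expR (I s t x) = 1 + variation ax s t x; last by ring.
have EI : expR (I s t x) != 0 by rewrite gt_eqF // expR_gt0.
by apply: (mulfI (invr_neq0 EI)); rewrite E mulVf.
Qed.

Lemma flow_orientation s t x : -1 < dx e s t x.
Proof.
rewrite (dxE flow_x_derivative) variation_ax /J /exp_primitive.
by have := expR_gt0 (1 * I s t x); lra.
Qed.

Lemma schwartz_flow : schwartz_family e.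
Proof.
pose K c := (exists2 phi, schwartz_family phi & c = shift_comp phi e) \/
  exists r, c = J r.
have Kest c : K c -> [/\ rapid c, tcont c & lipschitz_sx c].
  case=> [[phi Sphi ->]|[r ->]]; first exact: shift_flow_estimates.
  exact: exp_primitive_estimates.
have Kphi phi : schwartz_family phi -> closure_of K (shift_comp phi e).
  by move=> Sphi; apply: closure_base; left; exists phi.
have KJ r : closure_of K (J r) by apply: closure_base; right; exists r.
have Kvar w : closure_of K w -> closure_of K (variation w).
  move=> Kw; have KP : closure_of K (time_primitive (fun s t x => w s t x + w s t x * J (-1) s t x)).
    by apply: closure_primitive; apply: closure_add => //; apply: closure_mul.
  by apply: closure_add => //; apply: closure_mul.
have Kas : closure_of K as_ by apply: Kphi; exact: schwartz_family_ds.
have Kax : closure_of K ax by apply: Kphi; exact: schwartz_family_dx.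
have Sdx := schwartz_family_dx Sa.
have KI d r : closure_of K d -> closure_of K (fun s t x =>
    r * (time_primitive d s t x + J r s t x * time_primitive d s t x)).
  move=> Kd; apply: closure_scale; apply: closure_add; first exact: closure_primitive.
  by apply: closure_mul => //; exact: closure_primitive.
have HK : forall c, closure_of K c -> schwartz_family c.
  apply: schwartz_closure => c Kc; have [rc cc lc] := Kest c Kc; split => //.
    case: Kc => [[phi Sphi ->]|[r ->]].
      exists (fun s t x => shift_comp (ds phi) e s t x
          + shift_comp (dx phi) e s t x * variation as_ s t x).
        apply: closure_add; first by apply: Kphi; exact: schwartz_family_ds.
        by apply: closure_mul; [apply: Kphi; exact: schwartz_family_dx|exact: Kvar].
      apply: shift_comp_s_derivative => //; first exact: flow_lipschitz.
      exact: flow_s_derivative.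
    pose d : fam := fun s t x => shift_comp (ds (dx a)) e s t x
      + shift_comp (dx (dx a)) e s t x * variation as_ s t x.
    have Kd : closure_of K d.
      apply: closure_add; first by apply: Kphi; exact: schwartz_family_ds.
      by apply: closure_mul; [apply: Kphi; exact: schwartz_family_dx|exact: Kvar].
    (* [d] is the s-derivative of [ax]. Its estimates are at hand although the closure is not yet
       known to consist of differentiable families. *)
    have [_ cd ld] := closure_estimates Kest Kd.
    have dI : s_derivative I (time_primitive d).
      apply: s_derivative_primitive => //; apply: shift_comp_s_derivative => //.
        exact: flow_lipschitz.
      exact: flow_s_derivative.
    exists (fun s t x => r * (time_primitive d s t x + J r s t x * time_primitive d s t x)).
      exact: KI.
    move=> s t x.
    have E := @is_derive_comp_fun _ expR (fun s => r * I s t x) s _ _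
        (is_deriveZ r (dI s t x)) (is_derive_expR (r * I s t x)).
    have := is_deriveB E (is_derive_cst (1 : R) s 1).
    rewrite (_ : _ - 0 = r * (time_primitive d s t x + J r s t x * time_primitive d s t x)).
      by apply: is_derive_ext.
    by rewrite /J /exp_primitive /GRing.scale /=; ring.
  case: Kc => [[phi Sphi ->]|[r ->]].
    exists (fun s t x => shift_comp (dx phi) e s t x
        + shift_comp (dx phi) e s t x * variation ax s t x).
      apply: closure_add; first by apply: Kphi; exact: schwartz_family_dx.
      by apply: closure_mul; [apply: Kphi; exact: schwartz_family_dx|exact: Kvar].
    apply: shift_comp_x_derivative => //; first exact: flow_lipschitz.
    exact: flow_x_derivative.
  pose d : fam := fun s t x => shift_comp (dx (dx a)) e s t x
    + shift_comp (dx (dx a)) e s t x * variation ax s t x.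
  have Kd : closure_of K d.
    apply: closure_add; first by apply: Kphi; exact: schwartz_family_dx.
    by apply: closure_mul; [apply: Kphi; exact: schwartz_family_dx|exact: Kvar].
  have [_ cd ld] := closure_estimates Kest Kd.
  have dI : x_derivative I (time_primitive d).
    apply: x_derivative_primitive => //; apply: shift_comp_x_derivative => //.
      exact: flow_lipschitz.
    exact: flow_x_derivative.
  exists (fun s t x => r * (time_primitive d s t x + J r s t x * time_primitive d s t x)).
    exact: KI.
  move=> s t x.
  have E := @is_derive_comp_fun _ expR (fun x => r * I s t x) x _ _
        (is_deriveZ r (dI s t x)) (is_derive_expR (r * I s t x)).
  have := is_deriveB E (is_derive_cst (1 : R) x 1).
  rewrite (_ : _ - 0 = r * (time_primitive d s t x + J r s t x * time_primitive d s t x)).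
    by apply: is_derive_ext.
  by rewrite /J /exp_primitive /GRing.scale /=; ring.
(* The flow is not a generator: it enters the closure through its integral equation. *)
have -> : e = time_primitive (shift_comp a e); last first.
  by apply: HK; apply: closure_primitive; exact: Kphi.
apply/funext => s; apply/funext => t; apply/funext => x.
have [_ ce _] := shift_flow_estimates Sa.
have [p0 dp] := time_primitiveP s x ce.
have D t' : is_derive t' (1:R)
    (fun t => e s t x - time_primitive (shift_comp a e) s t x) 0.
  by have := is_deriveB (eE s x t') (dp t'); rewrite subrr.
by have := is_derive_0_is_cst t 0 D; rewrite e0 p0 subr0 => /subr0_eq.
Qed.

End FlowOfField.

(** Rapid decay gives |g| <= 1/2 as soon as |x| > 2 C; the remaining (s, x) form a compact square,
    where pointwise positivity is enough. *)
Lemma bounded_below_curve (g : R -> R -> R) :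
  schwartz_family (fun s _ x => g s x) -> (forall s x, -1 < g s x) ->
  bounded_below (fun s _ x => g s x).
Proof.
move=> Sg g1 B.
have [C C0 HC] := rapid_bound 1 B (schwartz_family_rapid Sg).
(* Lower bounds of the form 1 / (N + 1) weaken as N grows, as the compactness lemma requires. The
   radius v / (4 (D + 1)) below costs at most half of the value v. *)
have [N HN] : exists N, forall s x, `|s| <= Num.max B (2 * C) ->
    `|x| <= Num.max B (2 * C) -> N.+1%:R^-1 <= 1 + g s x.
  apply: locally_uniform_on_square.
    move=> N M s x NM H; apply: le_trans H.
    by rewrite lef_pV2 ?posrE // ler_nat.
  move=> s x; set v := 1 + g s x.
  have v0 : 0 < v by rewrite /v; have := g1 s x; lra.
  have [D D0 HD] := lipschitz_sx_bound (`|s| + 1) (schwartz_family_lipschitz Sg).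
  exists (Num.truncn (2 / v)); exists (Num.min 1 (v / (4 * (D + 1)))).
    by rewrite lt_min ltr01 divr_gt0 // mulr_gt0 // ltr_wpDl.
  move=> s' x'; rewrite !lt_min => /andP[s1 s2] /andP[x1 x2].
  have N2 : (Num.truncn (2 / v)).+1%:R^-1 <= v / 2.
    rewrite -[leRHS]invf_div lef_pV2 ?posrE ?divr_gt0 //.
    by apply/ltW; apply: real_truncnS_gt; exact: num_real.
  apply: (le_trans N2).
  have B1 : `|s| <= `|s| + 1 by rewrite lerDl.
  have B2 : `|s'| <= `|s| + 1.
    by have := ler_normD (s' - s) s; rewrite subrK; lra.
  have B3 : `|0 : R| <= `|s| + 1 by rewrite normr0 addr_ge0.
  have := HD s s' 0 x x' B1 B2 B3.
  rewrite ler_norml => /andP[+ _].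
  have D1 : 0 < 4 * (D + 1) by rewrite mulr_gt0 // ltr_wpDl.
  rewrite ltr_pdivlMr // in s2; rewrite ltr_pdivlMr // in x2.
  have := normr_ge0 (s' - s); have := normr_ge0 (x' - x).
  rewrite /v in s2 x2 v0 *; nra.
exists (Num.min (N.+1%:R^-1) (1 / 2)); first by rewrite lt_min invr_gt0 ltr0n divr_gt0.
move=> s t x sB tB; rewrite ge_min.
have sM : `|s| <= Num.max B (2 * C) by rewrite le_max sB.
have [xM|xM] := leP `|x| (Num.max B (2 * C)); first by rewrite HN.
apply/orP; right; have := HC s t x sB tB; rewrite expr1 normrM => H.
have x2 : 2 * C < `|x| by apply: le_lt_trans xM; rewrite le_max lexx orbT.
have : `|g s x| <= 1 / 2.
  rewrite leNgt; apply/negP => H2; move: H; rewrite leNgt => /negP; apply.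
  by have := normr_ge0 (g s x); nra.
by rewrite ler_norml; lra.
Qed.

End Flow.

(** * Smooth curves in the Schwartz space versus families *)

Section Curves.
Variable R : realType.
Local Notation fam := (R -> R -> R -> R).
Implicit Types (a b c : fam) (f g : R -> R).

(** Symmetry of second derivatives, from the mixed second difference and mean values first in x,
    then in s. It is wanted because seminorms of a difference quotient in s involve
    x-derivatives. *)
Lemma dx_ds_comm a : schwartz_family a -> dx (ds a) = ds (dx a).
Proof.
move=> Sa; apply: dxE; apply: x_derivative_quad => B.
have Sx := schwartz_family_dx Sa; have Sxs := schwartz_family_ds Sx.
have [C C0 HC] := lipschitz_sx_bound (B + 1) (schwartz_family_lipschitz Sxs).
exists C => s t x x' sB tB.
set k := x' - x; set M := ds (dx a) s t x.
have bound h : `|h| < 1 -> `|(a (s + h) t x' - a (s + h) t x) - (a s t x' - a s t x)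
     - h * (k * M)| <= `|h| * (C * `|k| * `|h| + C * k ^+ 2).
  move=> h1.
  have sB1 : `|s| <= B + 1 by rewrite (le_trans sB) // lerDl.
  have tB1 : `|t| <= B + 1 by rewrite (le_trans tB) // lerDl.
  have shB : `|s + h| <= B + 1 by rewrite (le_trans (ler_normD _ _)) // lerD // ltW.
  have [th thP E1] := mean_value x x' (fun y => is_deriveB
    (x_derivative_dx Sa (s + h) t y) (x_derivative_dx Sa s t y)).
  rewrite !fctE in E1; set y := x + th * (x' - x) in E1.
  have [th2 thP2 E2] := mean_value s (s + h) (fun s => s_derivative_ds Sx s t y).
  set sg := s + th2 * (s + h - s) in E2.
  have -> : a (s + h) t x' - a (s + h) t x - (a s t x' - a s t x) - h * (k * M) =
      (ds (dx a) sg t y - M) * h * k.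
    transitivity ((a (s + h) t x' - a s t x') - (a (s + h) t x - a s t x) - h * (k * M)).
      by ring.
    by rewrite E1 E2 -/k [s + h]addrC addrK; ring.
  rewrite !normrM mulrAC mulrC ler_wpM2l //.
  have sgB : `|sg| <= B + 1 by apply: norm_segment_le.
  have := HC s sg t x y sB1 sgB tB1.
  have -> : sg - s = th2 * h by rewrite /sg; ring.
  have -> : y - x = th * k by rewrite /y /k; ring.
  have [t0 t1] := andP thP; have [t20 t21] := andP thP2.
  rewrite !normrM (ger0_norm t0) (ger0_norm t20) => W.
  apply: (@le_trans _ _ (C * (`|h| + `|k|) * `|k|)).
    by rewrite ler_wpM2r // (le_trans W) // ler_wpM2l // lerD // ler_piMl.
  by rewrite -[in leRHS](real_normK (num_real k)) le_eqVlt; apply/orP; left; apply/eqP; ring.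
have eta : is_derive s (1:R) (fun s => a s t x' - a s t x) (ds a s t x' - ds a s t x).
  exact: is_deriveB (s_derivative_ds Sa s t x') (s_derivative_ds Sa s t x).
(* [ds a] is a limit of difference quotients, so the bound is shown up to an arbitrary [e]; the step
   [h] below is small enough for each of two errors to be at most h e / 2. *)
rewrite -/k -/M; apply/ler_addgt0Pr => e e0.
have [d d0 Hd] := iffLR (is_deriveP_eps _ _ _) eta _ (divr_gt0 e0 (ltr0n R 2)).
pose A := C * `|k|; have A0 : 0 <= A by rewrite mulr_ge0.
pose h := Num.min (1 / 2) (Num.min (d / 2) (e / (2 * (A + 1)))).
have h0 : 0 < h by rewrite !lt_min !divr_gt0 // mulr_gt0 // ltr_wpDl.
have h12 : h <= 1 / 2 by rewrite ge_min lexx.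
have hd : h <= d / 2 by rewrite !ge_min lexx !orbT.
have he : h <= e / (2 * (A + 1)) by rewrite !ge_min lexx !orbT.
have nh : `|h| = h by rewrite gtr0_norm.
have h1 : `|h| < 1 by rewrite nh; lra.
have hd' : `|h| < d by rewrite nh; lra.
have W1 := bound h h1; have W2 := Hd h hd'.
rewrite nh -/A in W1 W2.
have Ah : A * h <= e / 2.
  have A1 : 0 < 2 * (A + 1) by rewrite mulr_gt0 // ltr_wpDl.
  by rewrite ler_pdivlMr // in he; nra.
rewrite -(ler_pM2l h0) -{1}nh -normrM.
set u := a (s + h) t x' - a (s + h) t x - (a s t x' - a s t x) in W1 W2.
have -> : h * (ds a s t x' - ds a s t x - k * M) =
  (u - h * (k * M)) - (u - h * (ds a s t x' - ds a s t x)) by ring.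
rewrite (le_trans (ler_normB _ _)) // (le_trans (lerD W1 W2)) //.
rewrite [e / 2 * h]mulrC -mulrDr ler_pM2l //.
by rewrite [leRHS]addrC [e]splitr; lra.
Qed.

Lemma schwartz_iter_dx n a : schwartz_family a -> schwartz_family (iter n (@dx R) a).
Proof. by move=> Sa; elim: n => //= n IH; exact: schwartz_family_dx. Qed.

Lemma schwartz_iter_ds n a : schwartz_family a -> schwartz_family (iter n (@ds R) a).
Proof. by move=> Sa; elim: n => //= n IH; exact: schwartz_family_ds. Qed.

Lemma iter_dx_ds_comm n a : schwartz_family a ->
  iter n (@dx R) (ds a) = ds (iter n (@dx R) a).
Proof.
by move=> Sa; elim: n => //= n ->; rewrite dx_ds_comm //; exact: schwartz_iter_dx.
Qed.

Lemma derive1n_iter_dx n a s t : derive1n n (a s t) = iter n (@dx R) a s t.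
Proof. by elim: n => [|n IH]; rewrite ?derive1n0 // derive1nS IH. Qed.

Lemma schwartz_slice a s t : schwartz_family a -> schwartz (a s t).
Proof.
move=> Sa; split.
  by move=> n x; rewrite derive1n_iter_dx;
    have [] := x_derivative_dx (schwartz_iter_dx n Sa) s t x.
move=> k n.
have [C HC] := schwartz_family_rapid (schwartz_iter_dx n Sa) k (Num.max `|s| `|t|).
exists C => x; rewrite derive1n_iter_dx; apply: HC; rewrite le_max lexx //.
by rewrite orbT.
Qed.

Lemma derive1n_linear f g (al be : R) n : smoothf f -> smoothf g ->
  derive1n n (fun y => al * f y + be * g y) =
  fun y => al * derive1n n f y + be * derive1n n g y.
Proof.
move=> sf sg; elim: n => [|n IH]; rewrite ?derive1n0 // !derive1nS IH.
apply/funext => y; apply: is_derive_derive1.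
apply: (@is_deriveD _ _ _ (fun y => al * derive1n n f y)).
  exact: is_deriveZ (derivable_is_derive1 (sf n y)).
exact: is_deriveZ (derivable_is_derive1 (sg n y)).
Qed.

Lemma smoothf_linear f g (al be : R) : smoothf f -> smoothf g ->
  smoothf (fun y => al * f y + be * g y).
Proof.
move=> sf sg n y; rewrite derive1n_linear //.
have [] // : is_derive y (1:R) (fun y => al * derive1n n f y + be * derive1n n g y)
  (al * derive1n n.+1 f y + be * derive1n n.+1 g y).
rewrite !derive1nS; apply: (@is_deriveD _ _ _ (fun y => al * derive1n n f y)).
  exact: is_deriveZ (derivable_is_derive1 (sf n y)).
exact: is_deriveZ (derivable_is_derive1 (sg n y)).
Qed.

Lemma derive1n_quotient f g (V : R -> R) (h : R) n x :
  smoothf f -> smoothf g -> smoothf V ->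
  derive1n n (fun y => (f y - g y) / h - V y) x =
  (derive1n n f x - derive1n n g x) / h - derive1n n V x.
Proof.
move=> sf sg sV.
have -> : (fun y => (f y - g y) / h - V y) =
    (fun y => 1 * (h^-1 * f y + - h^-1 * g y) + -1 * V y).
  by apply/funext => y; ring.
rewrite derive1n_linear //; last exact: smoothf_linear.
by rewrite derive1n_linear //; ring.
Qed.

(** Two mean values in s write the error of the difference quotient of the n-th x-derivative as a
    second s-derivative times a number of size at most |h|. *)
Lemma curve_deriv_slice a t0 s : schwartz_family a ->
  curve_deriv (fun s => a s t0) s (ds a s t0).
Proof.
move=> Sa; have Ss := schwartz_family_ds Sa; split; first exact: schwartz_slice.
move=> k n eps eps0.
set b := iter n (@dx R) a; have Sb : schwartz_family b by exact: schwartz_iter_dx.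
set B := Num.max (`|s| + 1) `|t0|.
have [C C0 HC] := rapid_bound k B (schwartz_family_rapid
  (schwartz_family_ds (schwartz_family_ds Sb))).
exists (Num.min 1 (eps / (C + 1))).
  by rewrite lt_min ltr01 divr_gt0 // ltr_wpDl.
move=> h /andP[h0]; rewrite lt_min => /andP[h1 he] x.
rewrite (derive1n_quotient _ _ _ (schwartz_slice _ _ Sa).1 (schwartz_slice _ _ Sa).1
  (schwartz_slice _ _ Ss).1).
rewrite !derive1n_iter_dx iter_dx_ds_comm // -/b.
have [th thP ->] := mean_value s (s + h) (fun s => s_derivative_ds Sb s t0 x).
rewrite [s + h - s]addrC addKr mulfK ?(normr_gt0 h) -?normr_gt0 //.
have [th2 thP2 ->] := mean_value s (s + th * h)
  (fun s => s_derivative_ds (schwartz_family_ds Sb) s t0 x).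
rewrite [s + th * h - s]addrC addKr mulrA normrM.
have tB : `|t0| <= B by rewrite le_max lexx orbT.
have sB : `|s| <= B by rewrite le_max lerDl ler01.
have shB : `|s + h| <= B.
  by rewrite le_max (le_trans (ler_normD _ _)) // lerD2l ltW.
have sthB : `|s + th * h| <= B.
  by have := norm_segment_le thP sB shB; rewrite [s + h - s]addrC addKr.
have := HC _ t0 x (norm_segment_le thP2 sB sthB) tB.
rewrite [s + th * h - s]addrC addKr => W.
have [t0' t1] := andP thP.
have thh : `|th * h| <= `|h| by rewrite normrM (ger0_norm t0') ler_piMl.
apply: (le_trans (ler_pM (normr_ge0 _) (normr_ge0 _) W thh)).
rewrite ltr_pdivlMr ?ltr_wpDl // in he.
by have := normr_ge0 h; nra.
Qed.

Lemma smooth_curve_slice a t0 : schwartz_family a -> smooth_curve (fun s => a s t0).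
Proof.
move=> Sa; exists (fun j s => iter j (@ds R) a s t0); split => // j s; split.
  by apply: schwartz_slice; exact: schwartz_iter_ds.
by apply: curve_deriv_slice; exact: schwartz_iter_ds.
Qed.

Lemma curve_deriv_seminorm (c : R -> R -> R) (s : R) (V : R -> R) (k n : nat) :
  (forall u, schwartz (c u)) -> curve_deriv c s V ->
  forall e, 0 < e -> exists2 d, 0 < d & forall h, `|h| < d -> forall x,
    `|x ^+ k * (derive1n n (c (s + h)) x - derive1n n (c s) x - h * derive1n n V x)|
      <= e * `|h|.
Proof.
move=> Sc [SV HV] e e0; have [d d0 Hd] := HV k n e e0.
exists d => // h hd x; have [->|h0] := eqVneq h 0.
  by rewrite addr0 subrr mul0r subrr mulr0 normr0 mulr0.
have := Hd h; rewrite normr_gt0 h0 hd => /(_ isT x).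
rewrite (derive1n_quotient _ _ _ (Sc _).1 (Sc _).1 SV.1).
move=> W.
have -> : x ^+ k * (derive1n n (c (s + h)) x - derive1n n (c s) x - h * derive1n n V x) =
  x ^+ k * ((derive1n n (c (s + h)) x - derive1n n (c s) x) / h - derive1n n V x) * h.
  by field.
by rewrite normrM ler_wpM2r.
Qed.

Lemma curve_deriv_pointwise (c : R -> R -> R) (s : R) (V : R -> R) (n : nat) x :
  (forall u, schwartz (c u)) -> curve_deriv c s V ->
  is_derive s (1:R) (fun s => derive1n n (c s) x) (derive1n n V x).
Proof.
move=> Sc cV; apply/is_deriveP_eps => e e0.
have [d d0 Hd] := curve_deriv_seminorm 0 n Sc cV e0.
by exists d => // h hd; have := Hd h hd x; rewrite expr0 mul1r.
Qed.

(** Differentiability bounds each seminorm near every time; compactness of [-B, B] comes from the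
    square lemma with a dummy second variable. *)
Lemma curve_seminorm_bounded (c : R -> R -> R) (k n : nat) :
  (forall u, schwartz (c u)) -> (forall u, exists V, curve_deriv c u V) ->
  forall B, exists C, forall s x, `|s| <= B -> `|x ^+ k * derive1n n (c s) x| <= C.
Proof.
move=> Sc dc B.
suff [N HN] : exists N, forall s s' : R, `|s| <= B -> `|s'| <= B ->
    forall x, `|x ^+ k * derive1n n (c s) x| <= N%:R.
  by exists N%:R => s x sB; exact: (HN s s).
apply: (@locally_uniform_on_square _
  (fun N s _ => forall x, `|x ^+ k * derive1n n (c s) x| <= N%:R)).
  by move=> N M s s' NM H x; rewrite (le_trans (H x)) // ler_nat.
move=> s s'; have [V cV] := dc s; have [SV _] := cV.
have [d d0 Hd] := curve_deriv_seminorm k n Sc cV ltr01.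
have [C HC] := (Sc s).2 k n; have [D HD] := SV.2 k n.
exists (Num.truncn (C + (1 + `|D|))).+1, (Num.min 1 d); first by rewrite lt_min ltr01.
move=> u u'; rewrite lt_min => /andP[u1 ud] _ x.
apply: (@le_trans _ _ (C + (1 + `|D|))); last first.
  by apply/ltW; apply: real_truncnS_gt; exact: num_real.
have := Hd (u - s) ud x; rewrite [s + _]addrC subrK mul1r => W.
have -> : x ^+ k * derive1n n (c u) x = x ^+ k * derive1n n (c s) x
  + (x ^+ k * (derive1n n (c u) x - derive1n n (c s) x - (u - s) * derive1n n V x)
  + (u - s) * (x ^+ k * derive1n n V x)) by ring.
rewrite (le_trans (ler_normD _ _)) // lerD ?HC // (le_trans (ler_normD _ _)) //.
rewrite lerD ?(le_trans W) ?(ltW u1) // normrM.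
rewrite -[leRHS]mul1r ler_pM // ?(ltW u1) //.
by rewrite (le_trans (HD x)) // ler_norm.
Qed.

(** The invariant class consists of all x-derivatives of all members of the given tower [D],
    constant in time. *)
Lemma smooth_curve_family (c : R -> R -> R) :
  smooth_curve c -> schwartz_family (fun s _ x => c s x).
Proof.
move=> [D [<- HD]].
have SD j u : schwartz (D j u) by case: (HD j u).
have dD j u : curve_deriv (D j) u (D j.+1 u) by case: (HD j u).
exists (fun b => exists j n, b = fun s _ x => derive1n n (D j s) x).
  by exists 0%N, 0%N.
move=> b [j [n ->]]; split.
- move=> k B; have [C HC] := @curve_seminorm_bounded (D j) k n (SD j)
    (fun u => ex_intro _ _ (dD j u)) B.
  by exists C => s t x sB _; exact: HC.
- by move=> s x t; exact: cvg_cst.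
- exists (fun s _ x => derive1n n (D j.+1 s) x); first by exists j.+1, n.
  by move=> s t x; exact: curve_deriv_pointwise.
- exists (fun s _ x => derive1n n.+1 (D j s) x); first by exists j, n.+1.
  move=> s t x; rewrite derive1nS; apply: derivable_is_derive1.
  by case: (SD j s) => + _; apply.
Qed.

End Curves.

(** * The Lie group structure *)

Section LieGroup.
Variable R : realType.
Implicit Types (f g : R -> R) (c : R -> R -> R).

Lemma derive1n_cst0 n : derive1n n (fun _ : R => 0 : R) = fun=> 0.
Proof.
elim: n => [//|n IH]; rewrite derive1nS IH; apply/funext => x.
exact: derive1_cst.
Qed.

Lemma schwartz0 : schwartz (fun _ : R => 0 : R).
Proof.
split=> [n x|k n]; first by rewrite derive1n_cst0; exact: derivable_cst.
by exists 0 => x; rewrite derive1n_cst0 mulr0 normr0.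
Qed.

(** Lets single Schwartz functions profit from the results on curves. *)
Lemma smooth_curve_cst f : schwartz f -> smooth_curve (fun=> f).
Proof.
move=> Sf; exists (fun j => if j is 0%N then fun=> f else fun _ _ => 0); split => // j t.
have S j' : schwartz ((if j' is 0%N then fun=> f else fun _ _ => 0) t).
  by case: j' => // _; exact: schwartz0.
split => //; split => [|k n e e0]; first exact: (S j.+1).
exists 1 => // h _ x.
have -> : (fun y => ((if j is 0%N then fun=> f else fun _ _ => 0) (t + h) y
    - (if j is 0%N then fun=> f else fun _ _ => 0) t y) / h - 0) = fun=> 0.
  by apply/funext => y; case: j => [|j]; rewrite subrr mul0r subrr.
by rewrite derive1n_cst0 mulr0 normr0 ltW.
Qed.

Lemma DiffS_bounded_below c : smooth_curve c -> (forall s, DiffS (c s)) ->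
  bounded_below (dx (fun s _ x => c s x)).
Proof.
move=> cc Dc; have Sx := schwartz_family_dx (smooth_curve_family cc).
by apply: (bounded_below_curve Sx) => s x; exact: (Dc s).2.
Qed.

(** At [t0] the gap 1 + f' is at least some d > 0 uniformly in x, and the x-derivative of the curve
    is Lipschitz in the parameter, also uniformly in x. *)
Lemma DiffS_open : cinf_open (@DiffS R).
Proof.
move=> c cc; rewrite openE => t0 /= Dt0; apply/nbhs_ballP.
have Sc := smooth_curve_family cc.
have [d d0 Hd] := DiffS_bounded_below (smooth_curve_cst Dt0.1) (fun=> Dt0) 0.
have [C C0 HC] := lipschitz_sx_bound (`|t0| + 1)
  (schwartz_family_lipschitz (schwartz_family_dx Sc)).
have C1 : 0 < C + 1 by rewrite ltr_wpDl.
exists (Num.min 1 (d / (C + 1))) => /=; first by rewrite lt_min ltr01 divr_gt0.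
move=> t; rewrite /ball /= distrC lt_min ltr_pdivlMr // => /andP[t1 td].
split; first exact: (@schwartz_slice _ _ t 0 Sc).
move=> x.
have B1 : `|t0| <= `|t0| + 1 by rewrite lerDl.
have B2 : `|t| <= `|t0| + 1.
  by have := ler_normD (t - t0) t0; rewrite subrK; lra.
have B3 : `|0 : R| <= `|t0| + 1 by rewrite normr0 addr_ge0.
have W := HC t0 t 0 x x B1 B2 B3; have := Hd 0 0 x; rewrite normr0 lexx => /(_ isT isT).
move: W; rewrite /dx subrr normr0 addr0 ler_norml => /andP[+ _].
have := normr_ge0 (t - t0); nra.
Qed.

Lemma DiffS_did : DiffS (@did R).
Proof.
by split; [exact: schwartz0|move=> x; rewrite /did derive1_cst; lra].
Qed.

Lemma smooth_dmul c1 c2 : smooth_curve c1 -> smooth_curve c2 ->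
  smooth_curve (fun t => dmul (c1 t) (c2 t)).
Proof.
move=> /smooth_curve_family S1 /smooth_curve_family S2.
exact: (smooth_curve_slice 0 (schwartz_add S2 (schwartz_shift_comp S1 S2))).
Qed.

Lemma is_derive_dmul f g x : schwartz f -> schwartz g ->
  is_derive x (1:R) (dmul f g)
    (derive1 g x + derive1 f (x + g x) * (1 + derive1 g x)).
Proof.
move=> [sf _] [sg _].
have dg : is_derive x (1:R) g (derive1 g x) by exact: derivable_is_derive1 (sg 0%N x).
apply: is_deriveD; apply: (@is_derive_comp_fun _ f (fun x => x + g x)).
exact: derivable_is_derive1 (sf 0%N _).
Qed.

Lemma DiffS_dmul f g : DiffS f -> DiffS g -> DiffS (dmul f g).
Proof.
move=> [Sf f1] [Sg g1]; split.
  have [D [D0 HD]] := smooth_dmul (smooth_curve_cst Sf) (smooth_curve_cst Sg).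
  by have [] := HD 0%N 0; rewrite D0.
(* One plus this derivative factors as (1 + f'(x + g)) (1 + g'). *)
move=> x; rewrite (is_derive_derive1 (is_derive_dmul x Sf Sg)).
by have := f1 (x + g x); have := g1 x; nra.
Qed.

Lemma shift_injective f : DiffS f -> injective (fun x => x + f x).
Proof.
move=> [[sf _] f1] x y /eqP; rewrite eq_sym -subr_eq0 => /eqP E.
have [th _ M] := mean_value x y (fun z => derivable_is_derive1 (sf 0%N z)).
have F := f1 (x + th * (y - x)); set d := derive1 f _ in F.
have M' : f y - f x = d * (y - x) by [].
have E' : (y - x) * (1 + d) = 0 by rewrite mulrDr mulr1 [_ * d]mulrC -M' -E; ring.
apply/esym/eqP; rewrite -subr_eq0.
by move/eqP: E'; rewrite mulf_eq0 => /orP[//|/eqP]; lra.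
Qed.

(** If |f| <= C, then z + f(z) takes the value y between y - C and y + C. *)
Lemma inverse_exists f : DiffS f -> exists g, forall y, g y + f (y + g y) = 0.
Proof.
move=> [[sf bf] _]; have [C HC] := bf 0%N 0%N.
have fC x : `|f x| <= C by have := HC x; rewrite expr0 mul1r.
have C0 : 0 <= C by apply: le_trans (fC 0).
suff /choice[g Hg] : forall y, exists z, z + f (y + z) = 0 by exists g.
move=> y; have H z : {for z, continuous (fun z => z + f z)}.
  apply: cvgD; first exact: cvg_id.
  exact: is_derive_continuous (derivable_is_derive1 (sf 0%N z)).
have [|||z _ zy] := @IVT R (fun z => z + f z) (y - C) (y + C) y.
- by rewrite lerBlDr -addrA lerDl addr_ge0.
- exact: continuous_subspaceT.
- have := fC (y - C); have := fC (y + C); rewrite !ler_norml => /andP[a1 a2] /andP[b1 b2].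
  by rewrite ge_min le_max; apply/andP; split; apply/orP; [left|right]; lra.
by exists (z - y); rewrite addrC subrKC -zy; ring.
Qed.

Definition dinv f := get [set g : R -> R | forall y, g y + f (y + g y) = 0].

Lemma dinvP f : DiffS f -> forall y, dinv f y + f (y + dinv f y) = 0.
Proof.
by move=> /inverse_exists[g Hg]; rewrite /dinv; case: xgetP => [h _ //|/(_ g)].
Qed.

Lemma smooth_dinv : smooth_on (@DiffS R) dinv.
Proof.
move=> c cc Dc; have Sc := smooth_curve_family cc.
apply: (@smooth_curve_slice _ (fun s _ x => dinv (c s) x) 0).
apply: (schwartz_inverse Sc (DiffS_bounded_below cc Dc)) => s t x.
exact: dinvP.
Qed.

Lemma dmul_dinv f : DiffS f -> dmul f (dinv f) = @did R.
Proof. by move=> Df; apply/funext => x; exact: dinvP. Qed.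

Lemma dinv_dmul f : DiffS f -> dmul (dinv f) f = @did R.
Proof.
move=> Df; apply/funext => x; rewrite /dmul /did.
have E := dinvP Df (x + f x).
have : x + f x + dinv f (x + f x) = x.
  apply: (shift_injective Df) => /=.
  by rewrite -addrA E addr0.
by rewrite -addrA => /(canRL (addKr _)) ->; rewrite addrC subrr.
Qed.

Lemma DiffS_dinv f : DiffS f -> DiffS (dinv f).
Proof.
move=> Df; have [Sf f1] := Df.
have Sg : schwartz (dinv f).
  have [D [D0 HD]] := smooth_dinv (smooth_curve_cst Sf) (fun=> Df).
  by have [] := HD 0%N 0; rewrite D0.
(* Differentiating [dmul f (dinv f) = did] gives (1 + f') (1 + g') = 1, so both factors have the
   same sign. *)
split => // x; have := is_derive_dmul x Sf Sg.
rewrite dmul_dinv // => H; have := is_derive_unique H (is_derive_cst (0 : R) x 1).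
set g' := derive1 _ x; set f' := derive1 f _ => E.
have F : 0 < 1 + f' by have := f1 (x + dinv f x); rewrite -/f'; lra.
have : 0 < (1 + f') * (1 + g') by rewrite (_ : _ * _ = 1) //; rewrite -[RHS]addr0 -E; ring.
by rewrite pmulr_rgt0 //; lra.
Qed.

Lemma DiffS_Lie_group : is_Lie_group_DiffS R.
Proof.
split; first exact: DiffS_open.
split; first exact: DiffS_did.
split; first exact: DiffS_dmul.
split; first by move=> c1 c2 h1 h2 _ _; exact: smooth_dmul.
exists dinv; split=> [f Df|]; last exact: smooth_dinv.
by rewrite dmul_dinv // dinv_dmul //; split; first exact: DiffS_dinv.
Qed.

End LieGroup.

(** * Smooth functions with bounded derivatives; bump functions *)

Section SmoothCurvesThroughSequences.
Variable R : realType.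
Implicit Types (f g : R -> R).

Lemma derive1n_of_jets (F : nat -> R -> R) :
  (forall n x, is_derive x (1:R) (F n) (F n.+1 x)) ->
  forall n, derive1n n (F 0%N) = F n.
Proof.
move=> dF; elim=> [|n IH]; rewrite ?derive1n0 // derive1nS IH.
by apply/funext => x; apply: is_derive_derive1.
Qed.

Lemma smoothf_of_jets (F : nat -> R -> R) :
  (forall n x, is_derive x (1:R) (F n) (F n.+1 x)) -> smoothf (F 0%N).
Proof.
by move=> dF n x; rewrite derive1n_of_jets //; have [] := dF n x.
Qed.

Lemma smoothf_cst (c : R) : smoothf (fun=> c).
Proof.
apply: (@smoothf_of_jets (fun n => if n is 0%N then fun=> c else fun=> 0)).
by case=> [|n] x; exact: is_derive_cst.
Qed.

Lemma smoothf_id : smoothf (fun u : R => u).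
Proof.
apply: (@smoothf_of_jets (fun n => match n with 0%N => id | 1%N => fun=> 1 | _ => fun=> 0 end)).
by case=> [|[|n]] x; [exact: is_derive_id|exact: is_derive_cst|exact: is_derive_cst].
Qed.

(** The one-variable analogue of [schwartz_family], with boundedness in place of decay. *)
Definition bounded_jets f := exists2 K : (R -> R) -> Prop, K f &
  forall g, K g -> (exists C, forall x, `|g x| <= C) /\
    exists2 g', K g' & forall x, is_derive x (1:R) g (g' x).

Lemma bounded_jets_smooth f : bounded_jets f -> smoothf f /\
  forall n, exists C, forall x, `|derive1n n f x| <= C.
Proof.
move=> [K Kf HK].
have Kn n : K (derive1n n f).
  elim: n => [//|n /HK[_ [g' Kg' dg]]]; rewrite derive1nS.
  by rewrite (_ : derive1 _ = g') //; apply/funext => x; exact: is_derive_derive1.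
split=> [n x|n]; first by have [_ [g' _ /(_ x)[]]] := HK _ (Kn n).
by have [] := HK _ (Kn n).
Qed.

Inductive algebra_generated (K : (R -> R) -> Prop) : (R -> R) -> Prop :=
| generated_base f : K f -> algebra_generated K f
| generated_add f g : algebra_generated K f -> algebra_generated K g ->
    algebra_generated K (fun x => f x + g x)
| generated_mul f g : algebra_generated K f -> algebra_generated K g ->
    algebra_generated K (fun x => f x * g x)
| generated_scale r f : algebra_generated K f -> algebra_generated K (fun x => r * f x).

Lemma bounded_jets_generated K :
  (forall f, K f -> (exists C, forall x, `|f x| <= C) /\
    exists2 f', algebra_generated K f' & forall x, is_derive x (1:R) f (f' x)) ->
  forall f, algebra_generated K f -> bounded_jets f.
Proof.
move=> HK f Af; exists (algebra_generated K) => // {f Af} f; elim=> {}f.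
- exact: HK.
- move=> g Kf [[C HC] [f' Kf' df]] Kg [[D HD] [g' Kg' dg]]; split.
    exists (C + D) => x; rewrite (le_trans (ler_normD _ _)) // lerD //.
  exists (fun x => f' x + g' x); first exact: generated_add.
  by move=> x; exact: is_deriveD.
- move=> g Kf [[C HC] [f' Kf' df]] Kg [[D HD] [g' Kg' dg]]; split.
    by exists (C * D) => x; rewrite normrM ler_pM.
  exists (fun x => f x * g' x + f' x * g x).
    by apply: generated_add; apply: generated_mul.
  by move=> x; exact: is_deriveM_fun.
- move=> g Kg [[D HD] [g' Kg' dg]]; split.
    by exists (`|f| * D) => x; rewrite normrM ler_wpM2l.
  exists (fun x => f * g' x); first exact: generated_scale.
  by move=> x; exact: is_deriveZ.
Qed.

Lemma bounded_jets_mul f g : bounded_jets f -> bounded_jets g ->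
  bounded_jets (fun x => f x * g x).
Proof.
move=> Bf Bg; apply: (@bounded_jets_generated bounded_jets).
  move=> {f g Bf Bg} f [K Kf HK]; have [bf [f' Kf' df]] := HK f Kf; split => //.
  by exists f' => //; apply: generated_base; exists K.
by apply: generated_mul; apply: generated_base.
Qed.

Lemma bounded_jets_affine f (a b : R) : bounded_jets f ->
  bounded_jets (fun x => f (a * x + b)).
Proof.
move=> [K Kf HK].
exists (fun h => exists r g, K g /\ h = fun x => r * g (a * x + b)).
  by exists 1, f; split => //; apply/funext => x; rewrite mul1r.
move=> h [r [g [Kg ->]]]; have [[C HC] [g' Kg' dg]] := HK g Kg; split.
  by exists (`|r| * C) => x; rewrite normrM ler_wpM2l.
exists (fun x => r * a * g' (a * x + b)); first by exists (r * a), g'.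
move=> x; rewrite -mulrA.
by apply: (@is_deriveZ _ _ _ (fun x => g (a * x + b))); apply: is_derive_affine.
Qed.

(** For [k = 0] the classical function exp(-1/x); the negative powers make the collection stable
    under differentiation. *)
Definition flat (k : nat) (x : R) : R := if 0 < x then x^-1 ^+ k * expR (- x^-1) else 0.

Lemma exprn_le_expR (y : R) n : 0 <= y -> y ^+ n <= n`!%:R * expR y.
Proof.
case: n => [|n] y0; first by rewrite expr0 fact0 mul1r -expR0 ler_expR.
rewrite mulrC -ler_pdivrMr ?ltr0n ?fact_gt0 //.
by apply: le_trans (expR_ge1Dxn n y0); rewrite lerDr.
Qed.

Lemma flat_ge0 k x : 0 <= flat k x.
Proof.
rewrite /flat; case: ifP => // x0.
by rewrite mulr_ge0 ?expR_ge0 // exprn_ge0 // invr_ge0 ltW.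
Qed.

(** From y^n <= n! exp(y) with y = 1/x and n = k + j. *)
Lemma flat_le k j x : 0 < x -> flat k x <= (k + j)`!%:R * x ^+ j.
Proof.
move=> x0; rewrite /flat x0 expRN ler_pdivrMr ?expR_gt0 //.
have y0 : 0 <= x^-1 by rewrite invr_ge0 ltW.
rewrite (_ : x ^+ j = (x^-1 ^+ j)^-1); last by rewrite exprVn invrK.
rewrite mulrAC ler_pdivlMr ?exprn_gt0 ?invr_gt0 // -exprD.
exact: exprn_le_expR.
Qed.

Lemma flat_bounded k : exists C, forall x, `|flat k x| <= C.
Proof.
exists (k`!%:R) => x; rewrite ger0_norm ?flat_ge0 //.
have [x0|x0] := ltP 0 x; first by have := @flat_le k 0 x x0; rewrite expr0 mulr1 addn0.
by rewrite /flat ltNge x0 /= ler0n.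
Qed.

Lemma is_derive_flat k x :
  is_derive x (1:R) (flat k) (- k%:R * flat k.+1 x + flat k.+2 x).
Proof.
have [x0|x0|<-] := ltrgtP 0 x.
- have x0' : x != 0 by rewrite gt_eqF.
  have dV : is_derive x (1:R) (fun y : R => y^-1) (- x ^- 2).
    have := @is_deriveV R id x _ 1 x0' (is_derive_id _ _).
    by rewrite /GRing.scale /= mulr1.
  have dE : is_derive x (1:R) (fun y : R => expR (- y^-1)) (expR (- x^-1) * x ^- 2).
    apply: (@is_derive_comp_fun _ expR (fun y : R => - y^-1)).
    by have := is_deriveN dV; rewrite opprK.
  have dP : is_derive x (1:R) (fun y : R => y^-1 ^+ k) (- k%:R * x^-1 ^+ k.+1).
    have := @is_deriveX _ _ (fun y : R => y^-1) k x 1 _ dV.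
    rewrite (_ : _ *: _ = - k%:R * x^-1 ^+ k.+1).
      by apply: is_derive_ext => y; rewrite exprfctE.
    rewrite /GRing.scale /=; case: k => [|k] /=.
      by rewrite !(mul0r, oppr0).
    by rewrite !exprS expr0 mulr1; field.
  apply: (@is_derive_local _ (fun y : R => y^-1 ^+ k * expR (- y^-1)) _ _ _ x x0).
    move=> y; rewrite ltr_distl => /andP[+ _]; rewrite subrr => y0.
    by rewrite /flat y0.
  have := is_deriveM_fun dP dE; congr is_derive; rewrite /flat x0.
  rewrite -[x ^- 2]exprVn !exprS expr0.
  move: (x^-1 ^+ k) (expR (- x^-1)) => P E.
  by move: (x^-1) => y; ring.
- rewrite /flat ltNge (ltW x0) /= mulr0 addr0.
  apply: (@is_derive_local _ (fun=> 0) _ _ _ (- x)); first by rewrite oppr_gt0.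
    move=> y; rewrite ltr_distl => /andP[_]; rewrite subrr => y0.
    by rewrite /flat ltNge (ltW y0).
- rewrite /flat ltxx mulr0 addr0.
  (* At the origin [flat_le] with j = 2 is the quadratic estimate for derivative 0. *)
  apply: (@is_derive_quad _ _ _ _ ((k + 2)`!%:R) 1) => // h _.
  rewrite add0r mulr0 subr0 -/(flat k h) -/(flat k 0) {2}/flat ltxx subr0.
  rewrite ger0_norm ?flat_ge0 //; have [h0|h0] := ltP 0 h; first exact: flat_le.
  by rewrite /flat ltNge h0 /= mulr_ge0 ?ler0n ?sqr_ge0.
Qed.

Lemma bounded_jets_flat : bounded_jets (flat 0).
Proof.
apply: (@bounded_jets_generated (fun f => exists k, f = flat k)); last first.
  by apply: generated_base; exists 0%N.
move=> f [k ->]; split; first exact: flat_bounded.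
exists (fun x => - k%:R * flat k.+1 x + flat k.+2 x); last exact: is_derive_flat.
apply: generated_add; first by apply: generated_scale; apply: generated_base; exists k.+1.
by apply: generated_base; exists k.+2.
Qed.

(** Positive on (0, 1) and zero elsewhere; its primitive rises from 0 to a constant c, which is
    normalized only in [bump_exists]. *)
Let step_density (x : R) := flat 0 x * flat 0 (-1 * x + 1).
Let step := primitive step_density.

Lemma step_density_jets : bounded_jets step_density.
Proof.
by apply: bounded_jets_mul; [|apply: bounded_jets_affine]; exact: bounded_jets_flat.
Qed.

Lemma step_properties : exists c : R, [/\ 0 < c, bounded_jets step,
  forall x, x <= 0 -> step x = 0 & forall x, 1 <= x -> step x = c].
Proof.
have [K KL HK] := step_density_jets.
have cw t : {for t, continuous step_density}.
  have [_ [g' _ dg]] := HK _ KL; exact: is_derive_continuous (dg t).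
have [s0 ds_] := primitiveP cw; rewrite -/step in s0 ds_.
have w0 x : x <= 0 -> step_density x = 0.
  by move=> x0; rewrite /step_density /flat ltNge x0 mul0r.
have w1 x : 1 <= x -> step_density x = 0.
  by move=> x1; rewrite /step_density {2}/flat ltNge (_ : _ <= 0) ?mulr0 //; lra.
have wp x : 0 <= step_density x by rewrite mulr_ge0 ?flat_ge0.
have mono x y : x <= y -> step x <= step y.
  by move=> xy; exact: (@nondecreasing_of_derive _ step step_density x y
    (fun z _ => ds_ z) (fun z _ => wp z)).
have mono' x y : (forall z, x <= z <= y -> step_density z = 0) -> x <= y -> step y <= step x.
  move=> H xy; rewrite -lerN2; apply: (@nondecreasing_of_derive _ (- step)
    (- step_density) x y (fun z _ => is_deriveN (ds_ z))) => // z zz.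
  by rewrite fctE H // oppr0.
have sl x : x <= 0 -> step x = 0.
  move=> x0; apply/eqP; rewrite eq_le -{1}s0 mono //= -s0 mono' // => z /andP[_].
  exact: w0.
have sr x : 1 <= x -> step x = step 1.
  by move=> x1; apply/eqP; rewrite eq_le (mono 1 x) // andbT mono' // => z /andP[/w1].
have c0 : 0 < step 1.
  have [th thP E] := mean_value (1 / 4 : R) (3 / 4) ds_.
  apply: (@lt_le_trans _ _ (step (3 / 4))); last by apply: mono; lra.
  have : 0 <= step (1 / 4) by rewrite -s0 mono //; lra.
  have [t0 t1] := andP thP.
  have : 0 < step_density (1 / 4 + th * (3 / 4 - 1 / 4)).
    rewrite /step_density /flat; do 2 (case: ifP => [_|/negP[]]; last by lra).
    by rewrite !expr0 !mul1r mulr_gt0 ?expR_gt0.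
  move: E; set d := step_density _; lra.
exists (step 1); split => //.
exists (fun f => f = step \/ K f); first by left.
move=> g [->|Kg]; split.
- exists (step 1) => x; rewrite ger0_norm.
    by have [x1|x1] := leP x 1; [exact: mono|rewrite sr // ltW].
  by have [x0|x0] := leP x 0; [rewrite sl|rewrite -s0 mono // ltW].
- by exists step_density => //; right.
- by have [] := HK g Kg.
- by have [_ [g' Kg' dg]] := HK g Kg; exists g' => //; right.
Qed.

(** The companion x chi(x) is included because it prescribes a velocity where chi prescribes a
    position. *)
Lemma bump_exists : exists chi : R -> R, [/\ bounded_jets chi,
  bounded_jets (fun x => x * chi x), forall x, `|x| <= 1 -> chi x = 1
  & forall x, 2 <= `|x| -> chi x = 0].
Proof.
have [c [c0 Bs sl sr]] := step_properties.
pose chi x := (c ^- 2) * (step (1 * x + 2) * step (-1 * x + 2)).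
have chi2 x : 2 <= `|x| -> chi x = 0.
  rewrite /chi ler_normr => /orP[x2|x2].
    by rewrite (sl (-1 * x + 2)) ?mulr0 //; lra.
  by rewrite (sl (1 * x + 2)) ?mul0r ?mulr0 //; lra.
have Bchi : bounded_jets chi.
  have B2 : bounded_jets (fun x => step (1 * x + 2) * step (-1 * x + 2)).
    by apply: bounded_jets_mul; exact: bounded_jets_affine.
  apply: (@bounded_jets_generated bounded_jets); last first.
    by apply: generated_scale; exact: generated_base.
  move=> f [K Kf HK]; have [bf [f' Kf' df]] := HK f Kf; split => //.
  by exists f' => //; apply: generated_base; exists K.
exists chi; split => //; last first.
  move=> x; rewrite ler_norml => /andP[x1 x2]; rewrite /chi !sr; [|lra|lra].
  by rewrite -expr2 mulVf // expf_neq0 // gt_eqF.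
have [K Kchi HK] := Bchi.
have vanish g g' : (forall x, is_derive x (1:R) g (g' x)) ->
    (forall x, 2 < `|x| -> g x = 0) -> forall x, 2 < `|x| -> g' x = 0.
  move=> dg g2 x x2; apply: is_derive_unique (dg x) _.
  apply: (@is_derive_local _ (fun=> 0) _ _ _ (`|x| - 2)).
  - by rewrite subr_gt0.
  - move=> y yx; rewrite g2 //.
    by have := ler_normD (x - y) y; rewrite subrK distrC; lra.
(* Multiplication by x keeps functions bounded only because they vanish for |x| > 2, a property
   inherited by derivatives. *)
pose L h := exists2 g, K g & (forall x, 2 < `|x| -> g x = 0) /\
  (h = g \/ h = fun x => x * g x).
have chiL : L (fun x => x * chi x).
  by exists chi => //; split; [move=> x /ltW/chi2|right].
apply: (@bounded_jets_generated L); last exact: generated_base.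
move=> h [g Kg [g2 hE]]; have [[C HC] [g' Kg' dg]] := HK g Kg.
have g'2 := vanish g g' dg g2.
have C0 : 0 <= C by apply: le_trans (HC 0).
case: hE => ->; split.
- by exists C.
- by exists g' => //; apply: generated_base; exists g' => //; split=> //; left.
- exists (2 * C) => x; rewrite normrM; have [x2|x2] := leP `|x| 2.
    by rewrite ler_pM.
  by rewrite g2 // normr0 mulr0 mulr_ge0.
- exists (fun x => x * g' x + g x).
    apply: generated_add; apply: generated_base; first by exists g' => //; split; [|right].
    by exists g => //; split => //; left.
  by move=> x; have := is_deriveM_fun (is_derive_id x 1) (dg x); rewrite mul1r.
Qed.

End SmoothCurvesThroughSequences.

(** * Smooth functions passing through fast convergent sequences *)

Section Boman.
Variable R : realType.

Lemma sum_geometric_le (K : R) N : 0 <= K -> \sum_(m < N) K / 2 ^+ m <= 2 * K.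
Proof.
move=> K0; suff -> : \sum_(m < N) K / 2 ^+ m = 2 * K - 2 * K / 2 ^+ N.
  by rewrite gerBl divr_ge0 ?mulr_ge0 // exprn_ge0.
elim: N => [|N IH]; first by rewrite big_ord0 expr0 divr1 subrr.
by rewrite big_ord_recr /= IH exprS; field; rewrite expf_neq0.
Qed.

(** Termwise differentiation: partial sums satisfy a Taylor estimate with constant [2 * K n.+2]
    independent of N, and the limit inherits it. *)
Lemma series_of_jets (F : nat -> nat -> R -> R) :
  (forall m n x, is_derive x (1:R) (F m n) (F m n.+1 x)) ->
  (forall n, exists K, forall m x, `|F m n x| <= K / 2 ^+ m) ->
  exists G : R -> R, smoothf G /\
    exists C, forall N x, `|\sum_(m < N) F m 0%N x - G x| <= C / 2 ^+ N.
Proof.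
move=> dF /choice[K HK].
have K0 n : 0 <= K n by have := le_trans (normr_ge0 _) (HK n 0%N 0); rewrite expr0 divr1.
pose S N n x := \sum_(m < N) F m n x.
have dS N n x : is_derive x (1:R) (S N n) (S N n.+1 x).
  by apply: (@is_derive_ext _ (\sum_(m < N) F m n)) => y; rewrite fct_sumE.
have SK N n x : `|S N n x| <= 2 * K n.
  apply: le_trans (sum_geometric_le N (K0 n)).
  by apply: (le_trans (ler_norm_sum _ _ _)); apply: ler_sum => m _.
have /choice[G HG] : forall n, exists g : R -> R, forall x N,
    `|S N n x - g x| <= 2 * K n / 2 ^+ N.
  move=> n.
  suff /choice[g Hg] : forall x, exists l, forall N, `|S N n x - l| <= 2 * K n / 2 ^+ N.
    by exists g.
  move=> x; apply: (@geometric_cauchy _ (fun N => S N n x)) => N.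
  by rewrite /S big_ord_recr /= [_ + F _ _ _]addrC addrK.
have dG n x : is_derive x (1:R) (G n) (G n.+1 x).
  apply: (@is_derive_quad _ _ _ _ (2 * K n.+2) 1) => // h h1.
  (* Three replacements of [G] by partial sums: two of order n, one of order n + 1 with weight |h| <
     1. *)
  apply: (@le_of_le_add_geometric _ _ _ (4 * K n + 2 * K n.+1)) => N.
  have -> : G n (x + h) - G n x - h * G n.+1 x =
    (S N n (x + h) - S N n x - h * S N n.+1 x) +
    (- (S N n (x + h) - G n (x + h)) + (S N n x - G n x) + h * (S N n.+1 x - G n.+1 x)).
    by ring.
  rewrite (le_trans (ler_normD _ _)) // lerD //.
    have [th thP ->] := mean_value x (x + h) (dS N n).
    rewrite [x + h - x]addrC addKr mulrC -mulrBr normrM.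
    have [th2 _ ->] := mean_value x (x + th * h) (dS N n.+1).
    rewrite [x + _ - x]addrC addKr !normrM mulrCA.
    have [t0 t1] := andP thP.
    rewrite -(real_normK (num_real h)) expr2 ler_pM ?mulr_ge0 ?SK //.
    by rewrite (ger0_norm t0) ler_wpM2l // ler_piMl.
  rewrite (le_trans (ler_normD _ _)) //.
  rewrite (_ : _ / 2 ^+ N = (2 * K n / 2 ^+ N + 2 * K n / 2 ^+ N) + 2 * K n.+1 / 2 ^+ N); last first.
    by field; rewrite expf_neq0.
  apply: lerD.
    by rewrite (le_trans (ler_normD _ _)) // normrN lerD ?HG.
  rewrite normrM -[leRHS]mul1r; apply: ler_pM => //; first exact: ltW.
exists (G 0%N); split; first exact: smoothf_of_jets dG.
by exists (2 * K 0%N) => N x; exact: HG.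
Qed.

(** The exponents satisfy m (n + 1) <= max(m, n + 1)^2. *)
Lemma super_geometric_le n m : (2 : R) ^+ (m * n) * (2 ^+ (m * m))^-1 <= 2 ^+ (n.+1 ^ 2) / 2 ^+ m.
Proof.
rewrite ler_pdivrMr ?exprn_gt0 // mulrAC ler_pdivlMr ?exprn_gt0 // -!exprD.
rewrite ler_eXn2l ?ltr1n // -mulnSr.
have [mn|nm] := leqP m n.+1.
  by rewrite (leq_trans (leq_mul mn (leqnn _))) // mulnn leq_addr.
by rewrite (leq_trans (leq_mul (leqnn m) (ltnW nm))) // leq_addl.
Qed.

(* The curve passes through [p m] with velocity [v m] at time [2 ^- m]; the
   super-geometric decay of [p] and [v] absorbs the factors [(8 * 2 ^+ m) ^+ n]
   produced by differentiating the rescaled bumps. *)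
Lemma smooth_through_sequence (p v : nat -> R) :
  (forall m, `|p m| <= (2 ^+ (m * m))^-1) -> (forall m, `|v m| <= (2 ^+ (m * m))^-1) ->
  exists2 a : R -> R, smoothf a & forall m u, `|u - 2 ^- m| <= 2 ^- m / 8 ->
    a u = p m + v m * (u - 2 ^- m).
Proof.
move=> pm vm.
have [chi [/bounded_jets_smooth[schi bchi] /bounded_jets_smooth[sxchi bxchi] chi1 chi2]] :=
  bump_exists R.
pose r m : R := 2 ^- m / 8.
have r0 m : 0 < r m by rewrite /r divr_gt0 // invr_gt0 exprn_gt0.
have r1 m : r m <= 1.
  rewrite /r ler_pdivrMr // mul1r (@le_trans _ _ 1) ?ler1n //.
  by rewrite invf_le1 ?exprn_gt0 // exprn_ege1 // ler1n.
(* This scale sends the window of radius 2^-m / 8 to |y| <= 1, where chi is 1, and confines the m-th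
   bump to radius 2^-m / 4. At points of the m-th window all other bumps vanish. *)
pose sc m : R := 8 * 2 ^+ m.
pose F m n u := sc m ^+ n * (p m * derive1n n chi (sc m * u - 8)
  + v m * r m * derive1n n (fun x => x * chi x) (sc m * u - 8)).
have dF m n x : is_derive x (1:R) (F m n) (F m n.+1 x).
  have E : F m n.+1 x = sc m ^+ n *
      (p m * (sc m * derive1n n.+1 chi (sc m * x - 8))
      + v m * r m * (sc m * derive1n n.+1 (fun x => x * chi x) (sc m * x - 8))).
    by rewrite /F exprS; ring.
  rewrite E; apply: (@is_deriveZ _ _ _ (fun u => p m * derive1n n chi (sc m * u - 8)
    + v m * r m * derive1n n (fun x => x * chi x) (sc m * u - 8))).
  apply: (@is_deriveD _ _ _ (fun u => p m * derive1n n chi (sc m * u - 8))).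
    apply: (@is_deriveZ _ _ _ (fun u => derive1n n chi (sc m * u - 8))).
    by apply: is_derive_affine; rewrite derive1nS; exact: derivable_is_derive1.
  apply: (@is_deriveZ _ _ _ (fun u => derive1n n (fun x => x * chi x) (sc m * u - 8))).
  by apply: is_derive_affine; rewrite derive1nS; exact: derivable_is_derive1.
have bF n : exists K, forall m x, `|F m n x| <= K / 2 ^+ m.
  have [C HC] := bchi n; have [D HD] := bxchi n.
  have C0 : 0 <= C by apply: le_trans (HC 0).
  have D0 : 0 <= D by apply: le_trans (HD 0).
  exists (8 ^+ n * (C + D) * 2 ^+ (n.+1 ^ 2)) => m x.
  set y := sc m * x - 8; set e : R := (2 ^+ (m * m))^-1.
  have e0 : 0 <= e by rewrite /e invr_ge0 exprn_ge0.
  rewrite /F -/y; set w := p m * _ + _.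
  have wle : `|w| <= e * (C + D).
    rewrite mulrDr (le_trans (ler_normD _ _)) // lerD //.
      by rewrite normrM ler_pM ?pm ?HC.
    rewrite normrM ler_pM ?HD // normrM -[leRHS]mulr1 ler_pM ?vm //.
    by rewrite ger0_norm ?r1 // ltW.
  rewrite normrM ger0_norm ?exprn_ge0 ?mulr_ge0 ?exprn_ge0 //.
  rewrite /sc exprMn -exprM -!mulrA ler_wpM2l ?exprn_ge0 //.
  apply: (le_trans (ler_wpM2l _ wle)); first by rewrite exprn_ge0.
  rewrite [leLHS]mulrA [leLHS]mulrC ler_wpM2l ?addr_ge0 //.
  exact: super_geometric_le.
have [G [sG [C HC]]] := series_of_jets dF bF.
exists G => // m u hu.
have p2 : (0 : R) < 2 ^+ m by rewrite exprn_gt0.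
have um : 7 / 8 <= 2 ^+ m * u <= 9 / 8.
  have E : `|2 ^+ m * u - 1| <= 1 / 8.
    have -> : 2 ^+ m * u - 1 = 2 ^+ m * (u - 2 ^- m).
      by rewrite mulrBr mulfV // gt_eqF.
    rewrite normrM gtr0_norm // (le_trans (ler_wpM2l (ltW p2) hu)) //.
    by rewrite mulrA mulfV // gt_eqF.
  by move: E; rewrite ler_norml => /andP[e1 e2]; apply/andP; split; lra.
have Fm : F m 0%N u = p m + v m * (u - 2 ^- m).
  have y1 : `|sc m * u - 8| <= 1.
    by move: um => /andP[u1 u2]; rewrite /sc -mulrA ler_norml; apply/andP; split; lra.
  rewrite /F expr0 mul1r !derive1n0 chi1 // !mulr1; congr (_ + _).
  by rewrite -mulrA; congr (_ * _); rewrite /r /sc; field; rewrite gt_eqF.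
have F0 m' : m' != m -> F m' 0%N u = 0.
  move=> mm'; have y2 : 2 <= `|sc m' * u - 8|.
    move: um => /andP[u1 u2]; rewrite ler_normr /sc -mulrA.
    have u0 : 0 < u by rewrite -(pmulr_rgt0 _ p2); lra.
    have [lt|gt] : (m' < m \/ m < m')%N by apply/orP; rewrite -neq_ltn.
      have h : 2 ^+ m' * 2 <= (2 : R) ^+ m by rewrite -exprSr ler_eXn2l ?ltr1n.
      by apply/orP; right; have := ler_wpM2r (ltW u0) h; rewrite mulrAC; lra.
    have h : 2 ^+ m * 2 <= (2 : R) ^+ m' by rewrite -exprSr ler_eXn2l ?ltr1n.
    by apply/orP; left; have := ler_wpM2r (ltW u0) h; rewrite mulrAC; lra.
  by rewrite /F expr0 mul1r !derive1n0 chi2 // !mulr0 addr0.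
rewrite -Fm; apply/eqP; rewrite -subr_eq0 -normr_le0.
apply: (@le_of_le_add_geometric _ _ _ C) => N; rewrite add0r.
(* The shift by [m.+1] guarantees that the m-th term, the only nonzero one, is in the partial
   sum. *)
have := HC (N + m.+1)%N u.
rewrite (_ : \sum_(i < _) _ = F m 0%N u).
  rewrite distrC => /le_trans; apply.
  have C0 : 0 <= C.
    by have := le_trans (normr_ge0 _) (HC 0%N u); rewrite expr0 divr1.
  rewrite ler_wpM2l // lef_pV2 ?posrE ?exprn_gt0 // ler_eXn2l ?ltr1n //.
  by rewrite leq_addr.
have mN : (m < N + m.+1)%N by rewrite addnS ltnS leq_addl.
rewrite (bigD1 (Ordinal mN)) //= big1 ?addr0 // => i im; apply: F0.
by apply: contraNneq im => im; apply/eqP/val_inj.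
Qed.

End Boman.

(** * From smoothness along plane curves to Schwartz families *)

Section SmoothFamily.
Variable R : realType.

Lemma smoothf_addl (c : R) (a : R -> R) : smoothf a -> smoothf (fun u => c + a u).
Proof.
move=> sa; have := @smoothf_linear _ _ _ 1 1 (@smoothf_cst R c) sa.
by rewrite (_ : (fun y => _) = (fun u => c + a u)) //; apply/funext => u; rewrite !mul1r.
Qed.

Section PartialDerivatives.
Variables (X : R -> R -> R -> R) (U : R -> nat -> R -> R -> R).
Hypothesis smX : smooth_family X.
Hypothesis U0 : forall t, U t 0%N = fun s => X s t.
Hypothesis dU : forall t j s, schwartz (U t j s) /\ curve_deriv (U t j) s (U t j.+1 s).

Let u p n : R -> R -> R -> R := fun s t x => derive1n n (U t p s) x.

Lemma partial_s_derivative p n : s_derivative (u p n) (u p.+1 n).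
Proof.
move=> s t x; apply: curve_deriv_pointwise; last by case: (dU t p s).
by move=> s'; case: (dU t p s').
Qed.

(** Where [a] is affine with speed [la] and [b] is constant, the chain rule reduces to powers of
    [la]. This reads off partial derivatives in s from derivatives along the curve. *)
Lemma smooth_family_partial (a b : R -> R) (D : nat -> R -> R -> R) (s0 t0 la u0 d : R) :
  D 0%N = (fun w => X (a w) (b w)) ->
  (forall j w, schwartz (D j w) /\ curve_deriv (D j) w (D j.+1 w)) ->
  (forall w, `|w - u0| <= d -> a w = s0 + la * (w - u0)) ->
  (forall w, `|w - u0| <= d -> b w = t0) ->
  forall j w, `|w - u0| < d ->
    D j w = fun x => la ^+ j * U t0 j (s0 + la * (w - u0)) x.
Proof.
move=> D0 dD ha hb; elim=> [|j IH] w wd.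
  by rewrite D0 ha ?hb ?ltW // -(congr1 (fun f => f _) (U0 t0));
    apply/funext => x; rewrite expr0 mul1r.
apply/funext => x.
have dDj : is_derive w (1:R) (fun w => D j w x) (D j.+1 w x).
  have := @curve_deriv_pointwise _ (D j) w (D j.+1 w) 0 x; rewrite !derive1n0; apply.
    by move=> v; case: (dD j v).
  by case: (dD j w).
apply: is_derive_unique dDj _.
apply: (@is_derive_local _ (fun w => la ^+ j * U t0 j (s0 + la * (w - u0)) x) _ _ _
    (d - `|w - u0|)); first by rewrite subr_gt0.
  move=> v vw; rewrite IH //.
  by have := ler_normD (v - w) (w - u0); rewrite addrA subrK; lra.
rewrite exprSr -mulrA.
apply: (@is_deriveZ _ _ _ (fun w => U t0 j (s0 + la * (w - u0)) x)).
apply: (@is_derive_ext _ (fun w => U t0 j (la * w + (s0 - la * u0)) x)).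
  by move=> v; congr (U t0 j _ x); ring.
apply: (@is_derive_affine _ (fun s => U t0 j s x)).
have -> : la * w + (s0 - la * u0) = s0 + la * (w - u0) by ring.
exact: (@partial_s_derivative j 0).
Qed.

(* Boman's argument: if a seminorm of a partial derivative blew up along a
   sequence, a smooth curve through that sequence would have a derivative with
   unbounded seminorm. *)
Lemma partial_rapid p n : rapid (u p n).
Proof.
move=> k.
suff H : forall B, exists N : nat, forall s t : R, `|s| <= B -> `|t| <= B ->
    forall x, `|x ^+ k * u p n s t x| <= N%:R.
  by move=> B; have [N HN] := H B; exists N%:R => s t x sB tB; exact: HN.
apply: (@locally_uniform_on_square _
  (fun N s t => forall x, `|x ^+ k * u p n s t x| <= N%:R)).
  by move=> N M s t NM H x; rewrite (le_trans (H x)) // ler_nat.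
move=> s0 t0; apply: contrapT => nH.
have blowup (N : nat) (d : R) : 0 < d -> exists z : R * R * R,
    [/\ `|z.1.1 - s0| < d, `|z.1.2 - t0| < d & N%:R < `|z.2 ^+ k * u p n z.1.1 z.1.2 z.2|].
  move=> d0; apply: contrapT => nz; apply: nH; exists N, d => // s t sd td x.
  by rewrite leNgt; apply/negP => xN; apply: nz; exists (s, t, x).
pose la m : R := (2 ^+ (m * m))^-1.
have la0 m : 0 < la m by rewrite invr_gt0 exprn_gt0.
(* [la m] serves as distance to the limit point and as speed in s. The threshold compensates the
   factor [la m ^+ p], so the p-th derivative along the curve has seminorm above m at time 2^-m,
   while all these times lie in [-1, 1]. *)
have /choice[z Hz] := fun m => @blowup (m * 2 ^ (m * m * p))%N (la m) (la0 m).
have [|m|a sa Ha] := @smooth_through_sequence R (fun m => (z m).1.1 - s0) la.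
- by move=> m; have [/ltW] := Hz m.
- by rewrite gtr0_norm.
have [|m|b sb Hb] := @smooth_through_sequence R (fun m => (z m).1.2 - t0) (fun=> 0).
- by move=> m; have [_ /ltW] := Hz m.
- by rewrite normr0 ltW.
have [D [D0 dD]] := smX (@smoothf_addl s0 a sa) (@smoothf_addl t0 b sb).
have [C HC] := @curve_seminorm_bounded _ (D p) k n (fun w => (dD p w).1)
  (fun w => ex_intro _ _ (dD p w).2) 1.
pose m := (Num.truncn C).+1.
have Cm : C < m%:R by apply: real_truncnS_gt; exact: num_real.
have [_ _ zm] := Hz m.
have p2 : 0 < (2 : R) ^- m by rewrite invr_gt0 exprn_gt0.
have E := @smooth_family_partial _ _ D (z m).1.1 (z m).1.2 (la m) (2 ^- m) (2 ^- m / 8) D0 dD.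
have {}E : D p (2 ^- m) = fun x => la m ^+ p * U (z m).1.2 p (z m).1.1 x.
  have -> := E _ _ p (2 ^- m); rewrite ?subrr ?normr0 ?mulr0 ?addr0 ?divr_gt0 //.
  - by move=> w wd; rewrite (Ha m) //; ring.
  - by move=> w wd; rewrite (Hb m) //; ring.
have := HC (2 ^- m) (z m).2.
rewrite gtr0_norm // invf_le1 ?exprn_gt0 // exprn_ege1 ?ler1n // => /(_ isT).
have -> : derive1n n (D p (2 ^- m)) (z m).2 =
    la m ^+ p * u p n (z m).1.1 (z m).1.2 (z m).2.
  have sU := (dU (z m).1.2 p (z m).1.1).1.1.
  have := @derive1n_linear _ _ _ (la m ^+ p) 0 n sU sU.
  rewrite E; under eq_fun do rewrite mul0r addr0.
  by move=> ->; rewrite mul0r addr0.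
rewrite leNgt => /negP; apply; apply: (lt_trans Cm).
rewrite mulrCA normrM gtr0_norm ?exprn_gt0 //.
rewrite -ltr_pdivrMl ?exprn_gt0 //; apply: le_lt_trans zm.
by rewrite natrM natrX /la exprVn invrK -exprM [leLHS]mulrC.
Qed.

(** Induction on p: difference quotients in s of the p-th derivative are continuous in t and
    approximate the next one with error at most C h, locally uniformly in t by [partial_rapid] at
    order p + 2. *)
Lemma partial_tcont p n : tcont (u p n).
Proof.
elim: p => [|p IH] s x t.
  have [D [D0 dD]] := smX (@smoothf_cst R s) (@smoothf_id R).
  have H := @curve_deriv_pointwise _ (D 0%N) t (D 1%N t) n x
    (fun w => (dD 0%N w).1) (dD 0%N t).2.
  rewrite /u (_ : (fun t => _) = (fun t => derive1n n (D 0%N t) x)).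
    exact: is_derive_continuous H.
  by apply/funext => w; rewrite U0 D0.
apply/continuousP_eps => e e0.
set B := Num.max (`|s| + 1) (`|t| + 1).
have [C C0 HC] := rapid_bound0 B (@partial_rapid p.+2 n).
pose h := Num.min 1 (e / (3 * (C + 1))).
have C1 : 0 < 3 * (C + 1) by rewrite mulr_gt0 // ltr_wpDl.
have h0 : 0 < h by rewrite lt_min ltr01 divr_gt0.
have h1 : h <= 1 by rewrite ge_min lexx.
have hC : C * h <= e / 3.
  have : h <= e / (3 * (C + 1)) by rewrite ge_min lexx orbT.
  by rewrite ler_pdivlMr //; nra.
have quot w : `|w| <= B ->
    `|u p n (s + h) w x - u p n s w x - h * u p.+1 n s w x| <= h * (e / 3).
  move=> wB.
  have [th thP ->] := mean_value s (s + h) (fun s => @partial_s_derivative p n s w x).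
  have fac A A' : A * h - h * A' = h * (A - A') by ring.
  rewrite [s + h - s]addrC addKr fac normrM gtr0_norm // ler_pM2l //.
  have [th2 thP2 ->] := mean_value s (s + th * h)
    (fun s => @partial_s_derivative p.+1 n s w x).
  rewrite [s + _ - s]addrC addKr normrM.
  have [q0 q1] := andP thP.
  have sB : `|s| <= B by rewrite le_max lerDl ler01.
  have shB : `|s + h| <= B.
    by rewrite le_max (le_trans (ler_normD _ _)) // lerD2l gtr0_norm.
  have sthB : `|s + th * h| <= B.
    by have := norm_segment_le thP sB shB; rewrite [s + h - s]addrC addKr.
  have := HC _ w x (norm_segment_le thP2 sB sthB) wB.
  rewrite [s + th * h - s]addrC addKr => W.
  apply: le_trans hC; rewrite ler_pM // normrM ger0_norm // gtr0_norm //.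
  by rewrite ler_piMl // ltW.
have ep : 0 < h * (e / 6) by rewrite mulr_gt0 // divr_gt0.
have [d1 d10 H1] := iffLR (continuousP_eps _ _) (IH (s + h) x t) _ ep.
have [d2 d20 H2] := iffLR (continuousP_eps _ _) (IH s x t) _ ep.
exists (Num.min 1 (Num.min d1 d2)); first by rewrite !lt_min ltr01 d10.
move=> w; rewrite !lt_min => /and3P[w1 wd1 wd2].
have tB : `|t| <= B by rewrite le_max lerDl ler01 orbT.
have wB : `|w| <= B.
  by rewrite le_max; apply/orP; right; have := ler_normD (w - t) t; rewrite subrK; lra.
suff : `|h * u p.+1 n s w x - h * u p.+1 n s t x| <= h * e.
  by rewrite -mulrBr normrM gtr0_norm // ler_pM2l.
have := H1 w wd1; have := H2 w wd2; have := quot w wB; have := quot t tB.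
move: (u p n (s + h) w x) (u p n s w x) (u p n (s + h) t x) (u p n s t x) => a1 a2 a3 a4.
move: (h * u p.+1 n s w x) (h * u p.+1 n s t x) => b1 b2.
(* In units of h e / 6 the budget is 2 + 2 for the two quotients and 1 + 1 for the two continuity
   errors. *)
have -> : h * (e / 3) = 2 * (h * (e / 6)) by field.
have -> : h * e = 6 * (h * (e / 6)) by field.
move: (h * (e / 6)) => E; rewrite !ler_norml.
move=> /andP[? ?] /andP[? ?] /andP[? ?] /andP[? ?].
by apply/andP; split; lra.
Qed.

End PartialDerivatives.

(** For each t a tower of s-derivatives is chosen; their x-derivatives form the invariant class. *)
Lemma smooth_family_schwartz (X : R -> R -> R -> R) :
  smooth_family X -> schwartz_family X.
Proof.
move=> smX.
have /choice[U HU] : forall t, exists D : nat -> R -> R -> R,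
    D 0%N = (fun s => X s t) /\ forall j s, schwartz (D j s) /\ curve_deriv (D j) s (D j.+1 s).
  by move=> t; exact: smX (@smoothf_id R) (@smoothf_cst R t).
have U0 t : U t 0%N = fun s => X s t by case: (HU t).
have dU t j s : schwartz (U t j s) /\ curve_deriv (U t j) s (U t j.+1 s).
  by case: (HU t) => _; apply.
exists (fun b => exists p n, b = fun s t x => derive1n n (U t p s) x).
  by exists 0%N, 0%N; do 3 apply/funext => ?; rewrite U0.
move=> b [p [n ->]]; split.
- exact: (partial_rapid smX U0 dU).
- exact: (partial_tcont smX U0 dU).
- exists (fun s t x => derive1n n (U t p.+1 s) x); first by exists p.+1, n.
  exact: partial_s_derivative dU p n.
- exists (fun s t x => derive1n n.+1 (U t p s) x); first by exists p, n.+1.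
  move=> s t x; rewrite derive1nS; apply: derivable_is_derive1.
  by have [[+ _] _] := dU t p s; apply.
Qed.

End SmoothFamily.

(** * The evolution operator and regularity *)

Section Regularity.
Variable R : realType.

Definition evolution (X : R -> R -> R) : R -> R -> R := fun t x =>
  get [set y : R -> R | y 0 = 0 /\ forall t, is_derive t (1:R) y (X t (x + y t))] t.

Lemma evolutionP (X : R -> R -> R) : smooth_curve X ->
  (forall x, evolution X 0 x = 0) /\
  forall x t, is_derive t (1:R) (fun t => evolution X t x) (X t (x + evolution X t x)).
Proof.
move=> /smooth_curve_family SX.
suff H x : evolution X 0 x = 0 /\ forall t,
    is_derive t (1:R) (fun t => evolution X t x) (X t (x + evolution X t x)).
  by split=> x; case: (H x).
rewrite /evolution; case: xgetP => [y _ //|noy]; exfalso.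
have [|||y Hy] := @picard_lindelof R (fun t z => X t (x + z)); last exact: noy Hy.
- by move=> z t; exact: is_derive_continuous (s_derivative_ds SX t 0 (x + z)).
(* The maximum with 0 covers negative [B], for which the dummy time 0 would violate the bound. *)
- move=> B; have [C _ HC] := rapid_bound0 (Num.max B 0) (schwartz_family_rapid SX).
  exists C => t z tB; apply: (HC t 0 (x + z)).
    by rewrite le_max tB.
  by rewrite normr0 le_max lexx orbT.
- move=> B; have [C _ HC] := lipschitz_sx_bound (Num.max B 0) (schwartz_family_lipschitz SX).
  exists C => t z w tB; have tB' : `|t| <= Num.max B 0 by rewrite le_max tB.
  have := HC t t 0 (x + w) (x + z) tB' tB'.
  rewrite subrr normr0 add0r le_max lexx orbT => /(_ isT).
  by rewrite [x + z - _](_ : _ = z - w) //; ring.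
Qed.

(** Each s-derivative of b(s t, x) produces a factor t, whence the powers in [T]. The factor s does
    not decay in x and is no family by itself, so products with it are a second kind of
    generator. *)
Lemma schwartz_rescaled_time (a : R -> R -> R -> R) : schwartz_family a ->
  schwartz_family (fun s t x => s * a (s * t) 0 x).
Proof.
move=> Sa.
pose T (j : nat) (b : R -> R -> R -> R) : R -> R -> R -> R := fun s t x => t ^+ j * b (s * t) 0 x.
pose K (c : R -> R -> R -> R) := exists j b, schwartz_family b /\
  (c = T j b \/ c = fun s t x => s * T j b s t x).
have KT j b : schwartz_family b -> closure_of K (T j b).
  by move=> Sb; apply: closure_base; exists j, b; split=> //; left.
have KsT j b : schwartz_family b -> closure_of K (fun s t x => s * T j b s t x).
  by move=> Sb; apply: closure_base; exists j, b; split=> //; right.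
suff HK c : closure_of K c -> schwartz_family c.
  rewrite (_ : (fun s t x => _) = fun s t x => s * T 0%N a s t x); first exact/HK/KsT.
  by do 3 apply/funext => ?; rewrite /T expr0 mul1r.
have scaled (B s t : R) : `|s| <= B -> `|t| <= B -> `|s * t| <= B * B.
  by move=> sB tB; rewrite normrM ler_pM.
have Tb j b k (B : R) : schwartz_family b -> exists2 C : R, 0 <= C & forall s t x,
    `|s| <= B -> `|t| <= B -> `|x ^+ k * T j b s t x| <= C.
  move=> Sb; have [C C0 HC] := rapid_bound k (B * B) (schwartz_family_rapid Sb).
  exists (`|B| ^+ j * C) => [|s t x sB tB]; first by rewrite mulr_ge0 ?exprn_ge0.
  have B0 : 0 <= B by apply: le_trans tB.
  rewrite /T mulrCA normrM ler_pM // ?normrX ?lerXn2r ?nnegrE //.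
    by rewrite (ger0_norm B0).
  by apply: HC; [exact: scaled|rewrite normr0 mulr_ge0].
have Tl j b (B : R) : schwartz_family b -> exists2 C : R, 0 <= C & forall s s' t x x',
    `|s| <= B -> `|s'| <= B -> `|t| <= B ->
    `|T j b s' t x' - T j b s t x| <= C * (`|s' - s| + `|x' - x|).
  move=> Sb; have [C C0 HC] := lipschitz_sx_bound (B * B) (schwartz_family_lipschitz Sb).
  exists (`|B| ^+ j * (C * (`|B| + 1))).
    by rewrite !mulr_ge0 ?exprn_ge0 ?addr_ge0.
  move=> s s' t x x' sB s'B tB; have B0 : 0 <= B by apply: le_trans tB.
  rewrite /T -mulrBr normrM -mulrA ler_pM // ?normrX ?lerXn2r ?nnegrE //.
    by rewrite (ger0_norm B0).
  have := HC (s * t) (s' * t) 0 x x' (scaled _ _ _ sB tB) (scaled _ _ _ s'B tB).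
  rewrite normr0 mulr_ge0 // => /(_ isT) W; apply: (le_trans W).
  rewrite -mulrBl normrM -mulrA ler_wpM2l // (ger0_norm B0).
  have p0 := normr_ge0 (s' - s); have q0 := normr_ge0 (x' - x).
  have : `|s' - s| * `|t| <= `|s' - s| * B by rewrite ler_wpM2l.
  have := mulr_ge0 B0 q0; move: (`|s' - s| * `|t|) => w; nra.
have Tc j b : schwartz_family b -> tcont (T j b).
  move=> Sb s x t; apply: cvgM.
    exact: exprn_continuous.
  apply: (@continuous_comp _ _ _ (fun t => s * t) (fun u => b u 0 x)).
    by apply: cvgM; [exact: cvg_cst|exact: cvg_id].
  exact: is_derive_continuous (s_derivative_ds Sb (s * t) 0 x).
have Ts j b : schwartz_family b -> s_derivative (T j b) (T j.+1 (ds b)).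
  move=> Sb s t x.
  have -> : T j.+1 (ds b) s t x = t ^+ j * (t * ds b (s * t) 0 x).
    by rewrite /T exprSr mulrA.
  apply: (@is_deriveZ _ _ _ (fun s : R => b (s * t) 0 x)).
  have := @is_derive_affine _ (fun u => b u 0 x) t 0 s (ds b (s * t) 0 x).
  rewrite addr0 [t * s]mulrC => /(_ (s_derivative_ds Sb (s * t) 0 x)).
  by apply: is_derive_ext => w; rewrite addr0 mulrC.
have Tx j b : schwartz_family b -> x_derivative (T j b) (T j (dx b)).
  move=> Sb s t x; apply: (@is_deriveZ _ _ _ (fun x => b (s * t) 0 x)).
  exact: x_derivative_dx.
apply: schwartz_closure => {}c [j [b [Sb cE]]].
have Sds := schwartz_family_ds Sb; have Sdx := schwartz_family_dx Sb.
case: cE => ->; split.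
- by move=> k B; have [C _ HC] := Tb j b k B Sb; exists C.
- exact: Tc.
- by move=> B; have [C _ HC] := Tl j b B Sb; exists C.
- by exists (T j.+1 (ds b)); [exact: KT|exact: Ts].
- by exists (T j (dx b)); [exact: KT|exact: Tx].
- move=> k B; have [C C0 HC] := Tb j b k B Sb; exists (`|B| * C) => s t x sB tB.
  have B0 : 0 <= B by apply: le_trans tB.
  by rewrite mulrCA normrM ler_pM ?HC // (ger0_norm B0).
- by move=> s x t; apply: cvgM; [exact: cvg_cst|exact: Tc].
- move=> B; have [C C0 HC] := Tl j b B Sb; have [D D0 HD] := Tb j b 0%N B Sb.
  exists (`|B| * C + D) => s s' t x x' sB s'B tB.
  have B0 : 0 <= B by apply: le_trans tB.
  have -> : s' * T j b s' t x' - s * T j b s t x =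
    s' * (T j b s' t x' - T j b s t x) + (s' - s) * T j b s t x by ring.
  rewrite [leRHS]mulrDl (le_trans (ler_normD _ _)) // !normrM lerD //.
    by rewrite -mulrA ler_pM ?HC // (ger0_norm B0).
  rewrite [leLHS]mulrC ler_pM ?lerDl //.
  by have := HD s t x sB tB; rewrite expr0 mul1r -normrM.
- exists (fun s t x => T j b s t x + s * T j.+1 (ds b) s t x).
    by apply: closure_add; [exact: KT|exact: KsT].
  move=> s t x; have := is_deriveM_fun (is_derive_id s 1) (Ts j b Sb s t x).
  by rewrite mul1r addrC.
- exists (fun s t x => s * T j (dx b) s t x); first exact: KsT.
  by move=> s t x; apply: is_deriveZ; exact: Tx.
Qed.

Lemma evolution_properties (X : R -> R -> R) : smooth_curve X ->
  smooth_curve (evolution X) /\ forall t, DiffS (evolution X t).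
Proof.
move=> cX; have [e0 de] := evolutionP cX.
pose E s t x := evolution X (s * t) x.
have SA := schwartz_rescaled_time (smooth_curve_family cX).
have E0 s x : E s 0 x = 0 by rewrite /E mulr0.
have dE s x t : is_derive t (1:R) (fun t => E s t x)
    (shift_comp (fun s t x => s * X (s * t) x) E s t x).
  have := @is_derive_affine _ (fun t => evolution X t x) s 0 t
    (X (s * t) (x + evolution X (s * t) x)).
  rewrite addr0 => /(_ (de x (s * t))).
  by apply: is_derive_ext => w; rewrite addr0.
have SE := schwartz_flow SA E0 dE.
have E1 s : E s 1 = evolution X s by apply/funext => x; rewrite /E mulr1.
split.
  by rewrite (_ : evolution X = fun s => E s 1); [exact: smooth_curve_slice|apply/funext].
move=> t; split; first by rewrite -E1; exact: schwartz_slice.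
by move=> x; have := flow_orientation SA E0 dE t 1 x; rewrite /dx E1.
Qed.

Lemma evolution_equation (X : R -> R -> R) (t : R) : smooth_curve X ->
  exists V, Te_rtrans (evolution X t) (X t) V /\ curve_deriv (evolution X) t V.
Proof.
move=> cX; have [e0 de] := evolutionP cX.
have [[D [D0 HD]] _] := evolution_properties cX.
have V1 : D 1%N t = fun x => X t (x + evolution X t x).
  apply/funext => x; have [_ dD] := HD 0%N t.
  have := @curve_deriv_pointwise _ (D 0%N) t (D 1%N t) 0 x (fun u => (HD 0%N u).1) dD.
  by rewrite !derive1n0 D0 => H; exact: is_derive_unique H (de x t).
exists (D 1%N t); split; last by rewrite -D0; case: (HD 0%N t).
split; first by case: (HD 1%N t).
move=> k n eps eps0; exists 1 => // h /andP[h0 _] x.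
(* Right translation is affine in the chart, so the difference quotient equals its limit for every
   h. *)
have -> : (fun y => (dmul (fun x => (0 + h) * X t x) (evolution X t) y
    - dmul (fun x => 0 * X t x) (evolution X t) y) / h - D 1%N t y) = fun=> 0.
  apply/funext => y; rewrite V1 /dmul; field.
  by rewrite -normr_gt0.
by rewrite derive1n_cst0 mulr0 normr0 ltW.
Qed.

(** Here s is a genuine parameter of the field, so [schwartz_flow] applies to X itself and the slice
    at time 1 is taken. *)
Lemma evolution_smooth (X : R -> R -> R -> R) : smooth_family X ->
  smooth_curve (fun s => evolution (X s) 1).
Proof.
move=> smX; have SX := smooth_family_schwartz smX.
have cX s : smooth_curve (X s) := smX _ _ (@smoothf_cst R s) (@smoothf_id R).
apply: (@smooth_curve_slice _ (fun s t x => evolution (X s) t x) 1).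
by apply: (schwartz_flow SX) => [s x|s x t];
  [exact: (evolutionP (cX s)).1|exact: (evolutionP (cX s)).2].
Qed.

Lemma DiffS_regular : is_regular_DiffS R.
Proof.
exists evolution; split; last exact: evolution_smooth.
move=> X cX; have [ce De] := evolution_properties cX.
split; [exact: ce|split; [exact: De|split]].
  by apply/funext => x; exact: (evolutionP cX).1.
by move=> t; exact: evolution_equation.
Qed.

End Regularity.

Theorem theorem6p4 (R : realType) :
  is_Lie_group_DiffS R /\ is_regular_DiffS R.
Proof.
split; [exact: DiffS_Lie_group|exact: DiffS_regular].
Qed.
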